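(* Let $k$ be an algebraically closed field of characteristic $0$, $N$ a lattice of finite rank, $\sigma$ a strongly convex rational polyhedral cone in $N_{\mathbb{R}}$, and $N_0$ a sublattice of $N$ such that $N=N_0\oplus(\langle\sigma\rangle\cap N)$. Let $p\colon N\to N/N_0$ be the quotient map and $\sigma_0=p_{\mathbb{R}}(\sigma)$, which is a strongly convex rational polyhedral cone in $(N/N_0)_{\mathbb{R}}$, and let $p_*\colon X(\sigma)\to X(\sigma_0)$ be the induced toric morphism. Let $Y$ be a closed subscheme of $X(\sigma)$ and let $m_Y\colon T_N\times Y\to X(\sigma)$ be the multiplication morphism. If $m_Y$ is smooth, then $p_*|_Y\colon Y\to X(\sigma_0)$ is smooth at every point $y\in Y\cap O_\sigma$.
   Context: $T_N=\mathrm{Spec}(k[M])$ with $M$ the dual lattice of $N$; $\langle\sigma\rangle$ is the $\mathbb{R}$-linear span of $\sigma$; $X(\sigma)$ is the affine toric variety over $k$ of the cone $\sigma$ and $O_\sigma\subset X(\sigma)$ is the torus orbit corresponding to $\sigma$ (the closed orbit). The multiplication morphism $m_Y$ is the restriction to $T_N\times Y$ of the torus action $T_N\times X(\sigma)\to X(\sigma)$. *)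

(* Defs.v *)
From HB Require Import structures.
From mathcomp Require Import all_boot all_order all_algebra.
From mathcomp Require Import generic_quotient ring_quotient.
From mathcomp Require Import finmap boolp classical_sets reals.
From mathcomp Require Import mpoly monalg.

Set Implicit Arguments.
Unset Strict Implicit.
Unset Printing Implicit Defensive.

Import Order.TTheory GRing.Theory Num.Theory.
Local Open Scope classical_set_scope.
Local Open Scope ring_scope.

(** * Smooth ring homomorphisms *)

(* EGA IV 17.1.1, 17.3.1, for a morphism of affine schemes Spec B -> Spec A. *)
Definition formally_smooth (A B : comPzRingType) (f : {rmorphism A -> B}) :=
  forall (C C' : comPzRingType) (pi : {rmorphism C -> C'})
         (a : {rmorphism A -> C}) (b : {rmorphism B -> C'}),
    (forall y, exists x, pi x = y) ->
    (forall x y, pi x = 0 -> pi y = 0 -> x * y = 0) ->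
    (forall x, b (f x) = pi (a x)) ->
    exists c : {rmorphism B -> C},
      (forall x, c (f x) = a x) /\ (forall y, pi (c y) = b y).

(* mpoly n A is the polynomial ring written {mpoly A[n]} by its library; that
   notation is hidden here by the one of monalg. *)
Definition finitely_presented (A : comNzRingType) (B : comPzRingType)
    (f : {rmorphism A -> B}) :=
  exists n (F : {rmorphism mpoly n A -> B}) m (r : 'I_m -> mpoly n A),
    [/\ forall x, F (mpolyC n x) = f x,
        forall y, exists p, F p = y
      & forall p, F p = 0 <->
          exists c : 'I_m -> mpoly n A, p = \sum_i c i * r i].

Definition smooth (A : comNzRingType) (B : comPzRingType)
    (f : {rmorphism A -> B}) :=
  finitely_presented f /\ formally_smooth f.

Definition prime_ideal (B : comPzRingType) (q : set B) :=
  [/\ q 0, forall x y, q x -> q y -> q (x + y),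
      forall a x, q x -> q (a * x), ~ q 1
    & forall x y, q (x * y) -> q x \/ q y].

Definition is_localization (B Bg : comPzRingType) (g : B)
    (l : {rmorphism B -> Bg}) :=
  [/\ exists h, l g * h = 1,
      forall x, l x = 0 -> exists n, g ^+ n * x = 0
    & forall y, exists x n, l g ^+ n * y = l x].

(* Smoothness at the point q: smoothness on some basic open neighbourhood. *)
Definition smooth_at (A : comNzRingType) (B : comPzRingType)
    (f : {rmorphism A -> B}) (q : set B) :=
  exists2 g : B, ~ q g &
    exists (Bg : comPzRingType) (l : {rmorphism B -> Bg}),
      is_localization g l /\ smooth (l \o f : {rmorphism A -> Bg}).

(** * Groups of additive maps *)

Definition homZ (U V : zmodType) : Type := {additive U -> V}.

Section HomZ.
Variables U V : zmodType.
Implicit Types f g h : homZ U V.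

HB.instance Definition _ := gen_eqMixin (homZ U V).
HB.instance Definition _ := gen_choiceMixin (homZ U V).

Lemma homZP f g : (forall u, f u = g u) -> f = g.
Proof.
move=> fg; have /funext E : f =1 g by [].
case: f g E {fg} => [f [[cf]]] [g [[cg]]] /= E.
by case: _ / E cg => cg; rewrite (Prop_irrelevance cf cg).
Qed.

Fact homZ0_subproof : zmod_morphism (fun _ : U => 0 : V).
Proof. by move=> x y; rewrite subr0. Qed.
Fact homZN_subproof f : zmod_morphism (fun u => - f u).
Proof. by move=> x y; rewrite raddfB opprB opprK addrC. Qed.
Fact homZD_subproof f g : zmod_morphism (fun u => f u + g u).
Proof. by move=> x y; rewrite !raddfB opprD addrACA. Qed.

Definition homZ_mk (f : U -> V) (fB : zmod_morphism f) : homZ U V :=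
  HB.pack_for {additive U -> V} f (GRing.isZmodMorphism.Build U V f fB).

Lemma homZ_mkE f fB u : @homZ_mk f fB u = f u. Proof. by []. Qed.

Definition homZ0 := homZ_mk homZ0_subproof.
Definition homZN f := homZ_mk (homZN_subproof f).
Definition homZD f g := homZ_mk (homZD_subproof f g).

Fact homZDA : associative homZD.
Proof. by move=> f g h; apply: homZP => u /=; rewrite addrA. Qed.
Fact homZDC : commutative homZD.
Proof. by move=> f g; apply: homZP => u /=; rewrite addrC. Qed.
Fact homZ0D : left_id homZ0 homZD.
Proof. by move=> f; apply: homZP => u /=; rewrite add0r. Qed.
Fact homZND : left_inverse homZ0 homZN homZD.
Proof. by move=> f; apply: homZP => u /=; rewrite addNr. Qed.

HB.instance Definition _ :=
  GRing.isZmodule.Build (homZ U V) homZDA homZDC homZ0D homZND.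

Lemma homZ0E u : (0 : homZ U V) u = 0. Proof. by []. Qed.
Lemma homZNE f u : (- f) u = - f u. Proof. by []. Qed.
Lemma homZDE f g u : (f + g) u = f u + g u. Proof. by []. Qed.

End HomZ.

Section HomZLmod.
Variables (R : comNzRingType) (U : zmodType) (V : lmodType R).
Implicit Types f g : homZ U V.

Fact homZZ_subproof (a : R) f : zmod_morphism (fun u => a *: f u).
Proof. by move=> x y; rewrite raddfB scalerBr. Qed.

Definition homZZ (a : R) f : homZ U V := homZ_mk (homZZ_subproof a f).

Fact homZZA a b f : homZZ a (homZZ b f) = homZZ (a * b) f.
Proof. by apply: homZP => u /=; rewrite scalerA. Qed.
Fact homZZ1 : left_id 1 homZZ.
Proof. by move=> f; apply: homZP => u /=; rewrite scale1r. Qed.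
Fact homZZDr : right_distributive homZZ +%R.
Proof. by move=> a f g; apply: homZP => u /=; rewrite scalerDr. Qed.
Fact homZZDl f : {morph homZZ^~ f : a b / a + b}.
Proof. by move=> a b; apply: homZP => u /=; rewrite scalerDl. Qed.

HB.instance Definition _ := GRing.Zmodule_isLmodule.Build R (homZ U V)
  homZZA homZZ1 homZZDr homZZDl.

Lemma homZZE a f u : (a *: f) u = a *: f u. Proof. by []. Qed.

End HomZLmod.

(** * Lattices and cones *)

Definition is_lattice (N : zmodType) : Prop :=
  exists n (b : 'I_n -> N),
    forall v, exists! c : 'rV[int]_n, v = \sum_i b i *~ c 0 i.

Definition internal_direct_sum (N : zmodType) (A B : set N) : Prop :=
  forall v, exists! ab : N * N, [/\ A ab.1, B ab.2 & v = ab.1 + ab.2].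

Definition quotient_group (N : zmodType) (N0 : zmodClosed N) : zmodType :=
  Quotient.quot N0.

Definition quotient_map (N : zmodType) (N0 : zmodClosed N) :
  {additive N -> quotient_group N0} := \pi_(Quotient.quot N0)%qT.

Definition dual_lattice (N : zmodType) : zmodType := homZ N int.

(* For a lattice N with dual lattice M, the vector space N_R = N (x) R is
   realized as Hom(M, R); the inclusion of N is evaluation. *)
Definition realification (R : realType) (N : zmodType) : lmodType R :=
  homZ (dual_lattice N) R^o.

Section Cones.
Variables (R : realType) (N : zmodType).
Local Notation M := (dual_lattice N).
Local Notation NR := (realification R N).

Fact lattice_incl_subproof (v : N) :
  zmod_morphism (fun u : M => (u v)%:~R : R^o).
Proof. by move=> u u' /=; rewrite -rmorphB. Qed.

Definition lattice_incl (v : N) : NR := homZ_mk (lattice_incl_subproof v).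

Definition rational_polyhedral (s : set NR) : Prop :=
  exists n (v : 'I_n -> N),
    s = [set x | exists2 c : 'I_n -> R, (forall i, 0 <= c i)
                  & x = \sum_i c i *: lattice_incl (v i)].

Definition strongly_convex (s : set NR) : Prop :=
  forall x, s x -> s (- x) -> x = 0.

Definition real_span (s : set NR) : set NR :=
  [set x | exists n (y : 'I_n -> NR) (c : 'I_n -> R),
             (forall i, s (y i)) /\ x = \sum_i c i *: y i].

Definition span_lattice (s : set NR) : set N :=
  [set v | real_span s (lattice_incl v)].

Definition dual_cone (s : set NR) : {pred M} :=
  fun u => `[< forall x, s x -> 0 <= x u >].

Definition orthogonal_lattice (s : set NR) : {pred M} :=
  fun u => `[< forall x, s x -> x u = 0 >].

Fact dual_cone_addr_closed (s : set NR) : addr_closed (dual_cone s).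
Proof.
split=> [|u u' /asboolP su /asboolP su'].
  by apply/asboolP => x _; rewrite raddf0.
by apply/asboolP => x sx; rewrite raddfD /= addr_ge0 ?su ?su'.
Qed.
HB.instance Definition _ s :=
  GRing.isAddClosed.Build M (dual_cone s) (dual_cone_addr_closed s).

(* The semigroup (dual cone of s) /\ M. *)
Record cone_monoid (s : set NR) :=
  ConeMonoid { cone_char :> M; _ : dual_cone s cone_char }.

HB.instance Definition _ s := [isSub for @cone_char s].
HB.instance Definition _ s := [Choice of cone_monoid s by <:].
HB.instance Definition _ s := GRing.SubChoice_isSubNmodule.Build M
  (dual_cone s) (cone_monoid s) (dual_cone_addr_closed s).

Lemma cone_monoidP s (u : cone_monoid s) x : s x -> 0 <= x (cone_char u).
Proof. by case: u => u /= /asboolP; apply. Qed.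

Lemma orthogonalD s (u v : cone_monoid s) :
  ((u + v : cone_monoid s) : M) \in orthogonal_lattice s =
  ((u : M) \in orthogonal_lattice s) && ((v : M) \in orthogonal_lattice s).
Proof.
apply/asboolP/andP => [uv0|[/asboolP u0 /asboolP v0] x sx]; last first.
  by rewrite raddfD /= u0 ?v0 ?addr0.
suff: forall x, s x -> x (cone_char u) = 0 /\ x (cone_char v) = 0.
  by move=> H; split; apply/asboolP => x /H[].
move=> x sx; have := uv0 x sx; rewrite raddfD /= => /eqP.
by rewrite paddr_eq0 ?(cone_monoidP _ sx)// => /andP[/eqP-> /eqP->].
Qed.

End Cones.

Section LatticeMaps.
Variables (R : realType) (N N' : zmodType) (f : {additive N -> N'}).

Fact dual_map_subproof (u : dual_lattice N') : zmod_morphism (fun v => u (f v)).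
Proof. by move=> x y; rewrite !raddfB. Qed.

Definition dual_map (u : dual_lattice N') : dual_lattice N :=
  homZ_mk (dual_map_subproof u).

Fact dual_map_is_zmod_morphism : zmod_morphism dual_map.
Proof. by move=> u v; apply: homZP. Qed.
HB.instance Definition _ :=
  GRing.isZmodMorphism.Build _ _ dual_map dual_map_is_zmod_morphism.

Fact real_map_subproof (x : realification R N) :
  zmod_morphism (fun u => x (dual_map u)).
Proof. by move=> u v; rewrite !raddfB. Qed.

Definition real_map (x : realification R N) : realification R N' :=
  homZ_mk (real_map_subproof x).

Fact real_map_is_zmod_morphism : zmod_morphism real_map.
Proof. by move=> x y; apply: homZP. Qed.
HB.instance Definition _ :=
  GRing.isZmodMorphism.Build _ _ real_map real_map_is_zmod_morphism.

Lemma real_map_scale a x : real_map (a *: x) = a *: real_map x.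
Proof. exact: homZP. Qed.

Lemma real_map_incl v : real_map (lattice_incl R v) = lattice_incl R (f v).
Proof. exact: homZP. Qed.

Variable s : set (realification R N).

Fact cone_monoid_map_subproof (u : cone_monoid (real_map @` s)) :
  dual_map u \in dual_cone s.
Proof.
apply/asboolP => x sx.
by have /= := @cone_monoidP _ _ _ u (real_map x); apply; exists x.
Qed.

Definition cone_monoid_map (u : cone_monoid (real_map @` s)) : cone_monoid s :=
  ConeMonoid (cone_monoid_map_subproof u).

Fact cone_monoid_map_is_nmod_morphism : nmod_morphism cone_monoid_map.
Proof.
split=> [|u v]; apply: val_inj => /=; first exact: raddf0.
exact: (raddfD dual_map).
Qed.
HB.instance Definition _ := GRing.isNmodMorphism.Build _ _ cone_monoid_map
  cone_monoid_map_is_nmod_morphism.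

End LatticeMaps.

Arguments cone_monoid_map {R N N'} f s u.

Section QuotientCone.
Variables (R : realType) (N : zmodType) (N0 : zmodClosed N).
Variable s : set (realification R N).
Local Notation p := (quotient_map N0).

Lemma rational_polyhedral_quotient :
  rational_polyhedral s -> rational_polyhedral (real_map p @` s).
Proof.
move=> [n [v ->]]; exists n, (fun i => p (v i)).
have mapE (c : 'I_n -> R) : real_map p (\sum_i c i *: lattice_incl R (v i)) =
    \sum_i c i *: lattice_incl R (p (v i)).
  rewrite (raddf_sum (real_map p)); apply: eq_bigr => i _.
  by rewrite /= real_map_scale real_map_incl.
apply/seteqP; split=> [_ [_ [c c0 ->] <-]|_ [c c0 ->]]; first by exists c.
by exists (\sum_i c i *: lattice_incl R (v i)); first by exists c.
Qed.

Lemma strongly_convex_quotient :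
  rational_polyhedral s -> strongly_convex s ->
  internal_direct_sum [set v | v \in N0] (span_lattice s) ->
  strongly_convex (real_map p @` s).
Proof.
move=> [n [v sE]] scS ds.
have dsE a b : a \in N0 -> span_lattice s b -> forall a' b',
    a' \in N0 -> span_lattice s b' -> a + b = a' + b' -> b = b'.
  move=> a0 bs a' b' a0' bs' e; have [ab [_ U]] := ds (a + b).
  have := U (a, b) (And3 a0 bs erefl).
  by rewrite (U (a', b') (And3 a0' bs' e)) => -[].
pose P w := projT1 (cid (ds w)).
have PE w : [/\ (P w).1 \in N0, span_lattice s (P w).2 & w = (P w).1 + (P w).2].
  by rewrite /P; case: cid => ab [].
have spanB x y : span_lattice s x -> span_lattice s y -> span_lattice s (x - y).
  move=> [m [X [c [sX eX]]]] [m' [Y [d [sY eY]]]].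
  exists (m + m')%N.
  exists (fun i => match split i with inl j => X j | inr j => Y j end).
  exists (fun i => match split i with inl j => c j | inr j => - d j end).
  split; first by move=> i; case: split.
  have -> : lattice_incl R (x - y) = lattice_incl R x - lattice_incl R y.
    by apply: homZP => u; rewrite /= raddfB /= rmorphB.
  rewrite eX eY big_split_ord /= -sumrN; congr (_ + _); apply: eq_bigr => i _.
    case: split_ordP => j; first by move/lshift_inj->.
    by move/eqP; rewrite eq_lrshift.
  rewrite -scaleNr.
  by case: split_ordP => j; [move/eqP; rewrite eq_rlshift | move/rshift_inj->].
have P2B : zmod_morphism (fun w => (P w).2).
  move=> x y; have [x0 xs xE] := PE x; have [y0 ys yE] := PE y.
  have [z0 zs zE] := PE (x - y).
  apply: (dsE _ _ z0 zs ((P x).1 - (P y).1)); rewrite ?rpredB //.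
    exact: spanB.
  by rewrite -zE [in LHS]xE [in LHS]yE opprD addrACA.
pose pr : homZ N N := homZ_mk P2B.
have prN0 w : w \in N0 -> pr w = 0.
  move=> w0; have [z0 zs zE] := PE w.
  apply: (dsE _ _ z0 zs w) => //; last by rewrite -zE addr0.
  by have := spanB _ _ zs zs; rewrite subrr.
have prS w : span_lattice s w -> pr w = w.
  move=> ws; have [z0 zs zE] := PE w.
  by apply: (dsE _ _ z0 zs 0); rewrite ?rpred0 -?zE ?add0r.
have sv i : s (lattice_incl R (v i)).
  rewrite sE; exists (fun j => (j == i)%:R) => [j|]; first exact: ler0n.
  rewrite (bigD1 i) //= eqxx scale1r big1 ?addr0 // => j /negPf ->.
  by rewrite scale0r.
have vL i : span_lattice s (v i).
  exists 1%N, (fun=> lattice_incl R (v i)), (fun=> 1).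
  by rewrite big_ord1 scale1r.
have sD x y : s x -> s y -> s (x + y).
  rewrite sE => -[c c0 ->] [d d0 ->]; exists (fun i => c i + d i).
    by move=> i; rewrite addr_ge0.
  by rewrite -big_split /=; apply: eq_bigr => i _; rewrite scalerDl.
have ker x : s x -> real_map p x = 0 -> x = 0.
  move=> sx px; apply: homZP => u.
  have wB : zmod_morphism (fun z : quotient_group N0 => u (pr (repr z))).
    move=> y z; have e : repr (y - z) - (repr y - repr z) \in N0.
      by rewrite Quotient.idealrBE raddfB /= !reprK.
    apply/eqP; rewrite -subr_eq0; apply/eqP.
    transitivity (u (pr (repr (y - z) - (repr y - repr z)))).
      by rewrite !(raddfB pr) !(raddfB u).
    by rewrite prN0 // raddf0.
  pose w : dual_lattice (quotient_group N0) := homZ_mk wB.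
  have wE : dual_map p w = dual_map pr u.
    apply: homZP => z; have e : repr (p z) - z \in N0.
      by rewrite Quotient.idealrBE reprK.
    apply/eqP; rewrite -subr_eq0; apply/eqP.
    transitivity (u (pr (repr (p z) - z))); last by rewrite prN0 // raddf0.
    by rewrite !(raddfB pr) !(raddfB u).
  have -> : x u = x (dual_map pr u).
    move: sx; rewrite sE => -[c c0 ->].
    have SE (z : dual_lattice N) : (\sum_i c i *: lattice_incl R (v i)) z =
        \sum_i c i * (z (v i))%:~R.
      by elim/big_rec2: _ => //= i y1 y2 _ <-.
    by rewrite !SE; apply: eq_bigr => i _; rewrite -[in LHS](prS _ (vL i)).
  by rewrite -wE; have := congr1 (fun h : realification R _ => h w) px.
move=> _ [x sx <-] [y sy yE].
have xy0 : x + y = 0 by apply: ker; [exact: sD | rewrite raddfD /= yE subrr].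
have yx : y = - x by apply/eqP; rewrite -addr_eq0 addrC xy0.
by rewrite (scS x sx) ?raddf0 // -yx.
Qed.

End QuotientCone.

(** * Monoid algebras *)

(* The library's product on malg requires a monoid without nontrivial units,
   which excludes k[M]. *)
Definition monoid_alg (R : comPzRingType) (K : nmodType) : Type := {malg R[K]}.

HB.instance Definition _ (R : comPzRingType) (K : nmodType) :=
  GRing.Zmodule.on (monoid_alg R K).

(* Locked to keep unification from unfolding finitely supported functions. *)
HB.lock Definition mterm (R : comPzRingType) (K : nmodType) (c : R) (u : K) :
  monoid_alg R K := << c *g u >>.
Canonical mterm_unlockable := Unlockable mterm.unlock.

HB.lock Definition ma_mul (R : comPzRingType) (K : nmodType)
    (g1 g2 : monoid_alg R K) : monoid_alg R K :=
  \sum_(u <- msupp g1) \sum_(v <- msupp g2)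
    mterm (mcoeff u g1 * mcoeff v g2) (u + v).
Canonical ma_mul_unlockable := Unlockable ma_mul.unlock.

(* The R-algebra map R[K] -> S with u |-> h u, if S is an R-algebra via f. *)
HB.lock Definition ma_lift (R S : comPzRingType) (K : nmodType)
    (f : R -> S) (h : K -> S) (g : monoid_alg R K) : S :=
  \sum_(u <- msupp g) f (mcoeff u g) * h u.
Canonical ma_lift_unlockable := Unlockable ma_lift.unlock.

Section MonoidAlg.
Variables (R : comPzRingType) (K : nmodType).
Local Notation A := (monoid_alg R K).
Implicit Types (g : A) (c : R) (u : K).

Local Notation mterm := (@mterm R K).
Local Notation ma_mul := (@ma_mul R K).

Lemma mcoeff_mterm c u v : mcoeff v (mterm c u) = c *+ (u == v).
Proof. by rewrite unlock mcoeffU. Qed.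
Lemma msupp_mterm c u : (msupp (mterm c u) `<=` [fset u])%fset.
Proof. by rewrite unlock msuppU_le. Qed.

Lemma mterm0 u : mterm 0 u = 0. Proof. by rewrite unlock monalgU0. Qed.
Lemma mtermD c d u : mterm (c + d) u = mterm c u + mterm d u.
Proof. by rewrite unlock monalgUD. Qed.

Lemma ma_expand g : g = \sum_(u <- msupp g) mterm (mcoeff u g) u.
Proof. by rewrite [LHS]monalgE mterm.unlock. Qed.

Lemma ma_ind (P : A -> Prop) :
  P 0 -> (forall c u g, P g -> P (mterm c u + g)) -> forall g, P g.
Proof.
move=> P0 PD g; rewrite [g]ma_expand.
by elim/big_rec: _ => // u h _; apply: PD.
Qed.

Lemma ma_mulEw (d1 d2 : {fset K}) g1 g2 :
  (msupp g1 `<=` d1)%fset -> (msupp g2 `<=` d2)%fset ->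
  ma_mul g1 g2 =
  \sum_(u <- d1) \sum_(v <- d2) mterm (mcoeff u g1 * mcoeff v g2) (u + v).
Proof.
move=> le1 le2; rewrite ma_mul.unlock (big_fset_incl _ le1) /=.
  apply/eq_bigr=> u _; apply/big_fset_incl => // v _ /mcoeff_outdom ->.
  by rewrite mulr0 mterm0.
move=> u _ /mcoeff_outdom g1u.
by rewrite big1 => // v _; rewrite g1u mul0r mterm0.
Qed.

Lemma ma_mulC : commutative ma_mul.
Proof.
move=> g1 g2; rewrite ma_mul.unlock exchange_big /=.
by apply: eq_bigr => u _; apply: eq_bigr => v _; rewrite mulrC addrC.
Qed.

Lemma ma_mulDl : left_distributive ma_mul +%R.
Proof.
move=> g1 g2 g.
rewrite (ma_mulEw (msuppD_le g1 g2) (fsubset_refl _)).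
rewrite (ma_mulEw (fsubsetUl (msupp g1) (msupp g2)) (fsubset_refl _)).
rewrite (ma_mulEw (fsubsetUr (msupp g1) (msupp g2)) (fsubset_refl _)).
rewrite -big_split /=; apply: eq_bigr => u _.
rewrite -big_split /=; apply: eq_bigr => v _.
by rewrite mcoeffD mulrDl mtermD.
Qed.

Lemma ma_mul0 : left_zero 0 ma_mul.
Proof. by move=> g; rewrite ma_mul.unlock msupp0 big_seq_fset0. Qed.

Lemma ma_mulDr : right_distributive ma_mul +%R.
Proof. by move=> g g1 g2; rewrite ma_mulC ma_mulDl !(ma_mulC _ g). Qed.

Lemma ma_mulUU c d u v :
  ma_mul (mterm c u) (mterm d v) = mterm (c * d) (u + v).
Proof.
rewrite (ma_mulEw (msupp_mterm _ _) (msupp_mterm _ _)) !big_seq_fset1.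
by rewrite !mcoeff_mterm !eqxx.
Qed.

Lemma ma_mulA : associative ma_mul.
Proof.
move=> f g h; elim/ma_ind: f => [|c u f IHf]; first by rewrite !ma_mul0.
rewrite !ma_mulDl IHf; congr (_ + _) => {IHf}.
elim/ma_ind: g => [|d v g IHg]; first by rewrite ma_mul0 ma_mulC !ma_mul0.
rewrite ma_mulDl !ma_mulDr ma_mulDl IHg; congr (_ + _) => {IHg}.
elim/ma_ind: h => [|e w h IHh]; last first.
  by rewrite !ma_mulDr IHh !ma_mulUU mulrA addrA.
by rewrite !(ma_mulC _ 0) !ma_mul0 ma_mulC ma_mul0.
Qed.

Lemma ma_mul1 : left_id (mterm 1 0) ma_mul.
Proof.
move=> g; elim/ma_ind: g => [|c u g IH]; first by rewrite ma_mulC ma_mul0.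
by rewrite ma_mulDr IH ma_mulUU mul1r add0r.
Qed.

HB.instance Definition _ := GRing.Zmodule_isComPzRing.Build A
  ma_mulA ma_mulC ma_mul1 ma_mulDl.

Lemma mtermM c d u v : mterm c u * mterm d v = mterm (c * d) (u + v).
Proof. exact: ma_mulUU. Qed.

Definition mconst c : A := mterm c 0.
Definition mexp u : A := mterm 1 u.

Fact mconst_is_zmod_morphism : zmod_morphism mconst.
Proof. by move=> c d; rewrite /mconst unlock monalgUB. Qed.
Fact mconst_is_monoid_morphism : monoid_morphism mconst.
Proof. by split=> // c d; rewrite /mconst mtermM addr0. Qed.
HB.instance Definition _ :=
  GRing.isZmodMorphism.Build R A mconst mconst_is_zmod_morphism.
HB.instance Definition _ :=
  GRing.isMonoidMorphism.Build R A mconst mconst_is_monoid_morphism.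

Lemma mexp0 : mexp 0 = 1. Proof. by []. Qed.
Lemma mexpD u v : mexp (u + v) = mexp u * mexp v.
Proof. by rewrite /mexp mtermM mulr1. Qed.
Lemma mtermE c u : mterm c u = mconst c * mexp u.
Proof. by rewrite /mconst /mexp mtermM mulr1 add0r. Qed.

End MonoidAlg.

Section MonoidAlgNz.
Variables (R : comNzRingType) (K : nmodType).

Fact ma_oner_neq0 : (1 : monoid_alg R K) != 0.
Proof.
apply/eqP/malgP => /(_ 0) /eqP.
by rewrite -[1]/(mterm 1 0) mcoeff_mterm mcoeff0 eqxx oner_eq0.
Qed.
HB.instance Definition _ :=
  GRing.PzSemiRing_isNonZero.Build (monoid_alg R K) ma_oner_neq0.

End MonoidAlgNz.

(* Morphisms from the additive monoid K to the multiplicative monoid of S. *)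
Record expMorphism (K : nmodType) (S : comPzRingType) := ExpMorphism {
  exp_fun :> K -> S;
  exp_fun0 : exp_fun 0 = 1;
  exp_funD : forall u v, exp_fun (u + v) = exp_fun u * exp_fun v }.

Section MonoidAlgLift.
Variables (R S : comPzRingType) (K : nmodType).
Variables (f : {rmorphism R -> S}) (h : expMorphism K S).
Local Notation A := (monoid_alg R K).

Local Notation ma_lift := (@ma_lift R S K f h).

Lemma ma_liftEw (d : {fset K}) (g : A) : (msupp g `<=` d)%fset ->
  ma_lift g = \sum_(u <- d) f (mcoeff u g) * h u.
Proof.
move=> le; rewrite ma_lift.unlock [LHS](big_fset_incl _ le) //=.
move=> u _ /mcoeff_outdom ->.
by rewrite rmorph0 mul0r.
Qed.

Lemma ma_lift_term c u : ma_lift (mterm c u) = f c * h u.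
Proof.
by rewrite (ma_liftEw (msupp_mterm _ _)) big_seq_fset1 mcoeff_mterm eqxx.
Qed.

Fact ma_lift_is_zmod_morphism : zmod_morphism ma_lift.
Proof.
move=> g1 g2.
rewrite (ma_liftEw (msuppB_le g1 g2)).
rewrite (ma_liftEw (fsubsetUl (msupp g1) (msupp g2))).
rewrite (ma_liftEw (fsubsetUr (msupp g1) (msupp g2))).
by rewrite -sumrB; apply: eq_bigr => u _; rewrite mcoeffB rmorphB mulrBl.
Qed.
HB.instance Definition _ :=
  GRing.isZmodMorphism.Build A S ma_lift ma_lift_is_zmod_morphism.

Fact ma_lift_is_monoid_morphism : monoid_morphism ma_lift.
Proof.
split=> [|g1 g2].
  by rewrite -[1]/(mterm 1 0) ma_lift_term rmorph1 exp_fun0 mulr1.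
elim/ma_ind: g1 => [|c u g1 IH1]; first by rewrite mul0r raddf0 mul0r.
rewrite mulrDl !raddfD /= mulrDl IH1; congr (_ + _) => {IH1}.
elim/ma_ind: g2 => [|d v g2 IH2]; first by rewrite mulr0 raddf0 mulr0.
rewrite mulrDr !raddfD /= mulrDr IH2; congr (_ + _).
by rewrite mtermM !ma_lift_term rmorphM exp_funD mulrACA.
Qed.
HB.instance Definition _ :=
  GRing.isMonoidMorphism.Build A S ma_lift ma_lift_is_monoid_morphism.

Lemma ma_lift_const c : ma_lift (mconst K c) = f c.
Proof. by rewrite ma_lift_term exp_fun0 mulr1. Qed.
Lemma ma_lift_exp u : ma_lift (mexp R u) = h u.
Proof. by rewrite ma_lift_term rmorph1 mul1r. Qed.

Lemma ma_lift_uniq (F : {rmorphism A -> S}) :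
  (forall c, F (mconst K c) = f c) -> (forall u, F (mexp R u) = h u) ->
  F =1 ma_lift.
Proof.
move=> Fc Fe; elim/ma_ind => [|c u g IH]; first by rewrite !raddf0.
by rewrite !raddfD /= IH mtermE !rmorphM /= Fc Fe ma_lift_const ma_lift_exp.
Qed.

End MonoidAlgLift.

Definition mexp_morphism (R : comPzRingType) (K : nmodType) :
  expMorphism K (monoid_alg R K) := ExpMorphism (@mexp0 R K) (@mexpD R K).

(* R[K] -> S[K], i.e. the base change of R -> S along R -> R[K]. *)
Definition ma_map (R S : comPzRingType) (K : nmodType)
    (f : {rmorphism R -> S}) : monoid_alg R K -> monoid_alg S K :=
  ma_lift (mconst K \o f) (mexp_morphism S K).
HB.instance Definition _ R S K f := GRing.RMorphism.copy (@ma_map R S K f)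
  (ma_lift (mconst K \o f) (mexp_morphism S K)).

Lemma ma_map_const (R S : comPzRingType) (K : nmodType)
  (f : {rmorphism R -> S}) c : ma_map f (mconst K c) = mconst K (f c).
Proof. exact: (ma_lift_const (mconst K \o f) (mexp_morphism S K)). Qed.
Lemma ma_map_exp (R S : comPzRingType) (K : nmodType)
  (f : {rmorphism R -> S}) (u : K) : ma_map f (mexp R u) = mexp S u.
Proof. exact: (ma_lift_exp (mconst K \o f) (mexp_morphism S K)). Qed.

Section MonoidAlgReindex.
Variables (R : comPzRingType) (K K' : nmodType) (f : {additive K -> K'}).

Fact mexp_comp0 : mexp R (f 0) = 1. Proof. by rewrite raddf0. Qed.
Fact mexp_compD u v : mexp R (f (u + v)) = mexp R (f u) * mexp R (f v).
Proof. by rewrite raddfD mexpD. Qed.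

(* R[K] -> R[K'], mexp u |-> mexp (f u). *)
Definition ma_reindex : monoid_alg R K -> monoid_alg R K' :=
  ma_lift (mconst K') (ExpMorphism mexp_comp0 mexp_compD).
HB.instance Definition _ := GRing.RMorphism.copy ma_reindex
  (ma_lift (mconst K') (ExpMorphism mexp_comp0 mexp_compD)).

Lemma ma_reindex_const c : ma_reindex (mconst K c) = mconst K' c.
Proof. exact: (ma_lift_const (mconst K') (ExpMorphism _ _)). Qed.
Lemma ma_reindex_exp u : ma_reindex (mexp R u) = mexp R (f u).
Proof. exact: (ma_lift_exp (mconst K') (ExpMorphism _ _)). Qed.

End MonoidAlgReindex.

(* B[K] is the tensor product B (x)_k k[K]: it is the pushout of k -> B and
   k -> k[K].  Thus Spec B[M] = T_N x Spec B, for M the dual lattice of N. *)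
Lemma monoid_alg_pushout (k B C : comPzRingType) (K : nmodType)
    (i : {rmorphism k -> B}) (b : {rmorphism B -> C})
    (m : {rmorphism monoid_alg k K -> C}) :
  (forall c, b (i c) = m (mconst K c)) ->
  exists F : {rmorphism monoid_alg B K -> C},
    [/\ forall x, F (mconst K x) = b x,
        forall g, F (ma_map i g) = m g
      & forall F' : {rmorphism monoid_alg B K -> C},
          (forall x, F' (mconst K x) = b x) ->
          (forall g, F' (ma_map i g) = m g) -> F' =1 F].
Proof.
move=> bm.
have m0 : m (mexp k (0 : K)) = 1 by rewrite mexp0 rmorph1.
have mD (u v : K) : m (mexp k (u + v)) = m (mexp k u) * m (mexp k v).
  by rewrite mexpD rmorphM.
pose h := ExpMorphism m0 mD.
exists (ma_lift b h); split=> [x|g|F' Fb Fm].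
- exact: ma_lift_const.
- rewrite (ma_lift_uniq (f := m \o mconst K) (h := h) (F := m)) //.
  apply: (ma_lift_uniq (F := ma_lift b h \o ma_map i)) => [c|u] /=.
    by rewrite ma_map_const -bm; apply: (ma_lift_const b h).
  by rewrite ma_map_exp; apply: (ma_lift_exp b h).
- by apply: ma_lift_uniq => // u; rewrite -(ma_map_exp i) Fm.
Qed.

(** * Affine toric varieties *)

Section Toric.
Variables (k : fieldType) (R : realType) (N : zmodType).
Local Notation M := (dual_lattice N).

(* T_N = Spec (torus_ring k N) and X(s) = Spec (toric_ring k s). *)
Definition torus_ring : comNzRingType := monoid_alg k M.

Variable s : set (realification R N).

Definition toric_ring : comNzRingType := monoid_alg k (cone_monoid s).

Definition chi (u : cone_monoid s) : toric_ring := mexp k u.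

Definition action_exp_fun (u : cone_monoid s) : monoid_alg toric_ring M :=
  mconst M (chi u) * mexp toric_ring (u : M).
Fact action_exp_fun0 : action_exp_fun 0 = 1.
Proof. by rewrite /action_exp_fun /chi mexp0 rmorph1 mul1r. Qed.
Fact action_exp_funD u v :
  action_exp_fun (u + v) = action_exp_fun u * action_exp_fun v.
Proof.
have E1 : mconst M (chi (u + v)) = mconst M (chi u) * mconst M (chi v).
  by rewrite -(rmorphM (mconst M)); congr (mconst M _); apply: mexpD.
have E2 : mexp toric_ring (((u + v)%R : cone_monoid s) : M) =
          mexp toric_ring (u : M) * mexp toric_ring (v : M) by exact: mexpD.
by rewrite /action_exp_fun E1 E2 mulrACA.
Qed.

(* The action T_N x X(s) -> X(s), where T_N x X(s) = Spec k[S_s][M]; its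
   comorphism sends chi^u to chi^u (x) chi^u. *)
Definition torus_action : toric_ring -> monoid_alg toric_ring M :=
  ma_lift (mconst M \o mconst (cone_monoid s))
          (ExpMorphism action_exp_fun0 action_exp_funD).
HB.instance Definition _ := GRing.RMorphism.copy torus_action
  (ma_lift (mconst M \o mconst (cone_monoid s))
           (ExpMorphism action_exp_fun0 action_exp_funD)).

Lemma torus_action_chi u :
  torus_action (chi u) = mconst M (chi u) * mexp toric_ring (u : M).
Proof. exact: (ma_lift_exp (mconst M \o mconst _) (ExpMorphism _ _)). Qed.

(* For a closed subscheme (or any X(s)-scheme) Spec B -> X(s), the composite
   T_N x Spec B -> T_N x X(s) -> X(s). *)
Definition mult_morphism (B : comPzRingType)
    (rho : {rmorphism toric_ring -> B}) : toric_ring -> monoid_alg B M :=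
  ma_map rho \o torus_action.
HB.instance Definition _ B rho := GRing.RMorphism.copy (@mult_morphism B rho)
  (ma_map rho \o torus_action).

Definition dist_exp_fun (u : cone_monoid s) : k :=
  ((u : M) \in orthogonal_lattice s)%:R.
Fact dist_exp_fun0 : dist_exp_fun 0 = 1.
Proof.
have s0 : ((0 : cone_monoid s) : M) \in orthogonal_lattice s.
  by apply/asboolP => x _; rewrite raddf0.
by rewrite /dist_exp_fun s0.
Qed.
Fact dist_exp_funD u v : dist_exp_fun (u + v) = dist_exp_fun u * dist_exp_fun v.
Proof. by rewrite /dist_exp_fun orthogonalD -natrM mulnb. Qed.

(* The distinguished k-point of X(s): chi^u |-> 1 if u is orthogonal to s,
   and chi^u |-> 0 otherwise. *)
Definition distinguished_point : toric_ring -> k :=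
  ma_lift idfun (ExpMorphism dist_exp_fun0 dist_exp_funD).
HB.instance Definition _ := GRing.RMorphism.copy distinguished_point
  (ma_lift idfun (ExpMorphism dist_exp_fun0 dist_exp_funD)).

Lemma distinguished_point_chi u :
  distinguished_point (chi u) = ((u : M) \in orthogonal_lattice s)%:R.
Proof. exact: (ma_lift_exp idfun (ExpMorphism _ _)). Qed.

(* O_s, as a set of points of X(s): the image of T_N under t |-> t . x_s. *)
Definition torus_orbit : set (set toric_ring) :=
  [set p | exists2 P : set torus_ring, prime_ideal P &
             p = mult_morphism distinguished_point @^-1` P].

End Toric.

(* The toric morphism X(s) -> X(f_R(s)) induced by f : N -> N'. *)
Definition toric_morphism (k : fieldType) (R : realType) (N N' : zmodType)
    (f : {additive N -> N'}) (s : set (realification R N)) :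
    toric_ring k (real_map f @` s) -> toric_ring k s :=
  ma_reindex (R := k) (cone_monoid_map f s).
HB.instance Definition _ k R N N' f s := GRing.RMorphism.copy
  (@toric_morphism k R N N' f s) (ma_reindex (R := k) (cone_monoid_map f s)).

Arguments toric_morphism k {R N N'} f s x.

Lemma toric_morphism_chi (k : fieldType) (R : realType) (N N' : zmodType)
    (f : {additive N -> N'}) (s : set (realification R N)) u :
  toric_morphism k f s (chi k u) = chi k (cone_monoid_map f s u).
Proof. exact: ma_reindex_exp. Qed.

(* Main.v *)
(* Let M be the dual lattice of N, S the semigroup of sigma, S0 that of sigma_0.
   The direct sum decomposition of N splits S as S0 x (sigma^perp /\ M), so that
   k[S] is a Laurent polynomial ring over A0 = k[S0] and
   T_N x Y -> X(sigma) -> X(sigma_0) is still smooth, i.e. B[M] is smooth over A0.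
   Over a point y of O_sigma every nonzero u in S0 satisfies chi^u(y) = 0, so modulo
   the ideal of y the derivations e^u |-> lambda(u) of B[M] (with lambda in N),
   restricted to the unit section, kill A0. By formal smoothness they lift to
   A0-derivations B[M] -> B, whose matrix on a basis of M is invertible near y.
   Where it is, a lift B[M] -> E of a homomorphism B[M] -> B -> E/J, with J^2 = 0,
   can be corrected by these derivations to one trivial on M, whose restriction to
   B solves the lifting problem for A0 -> B. *)
From HB Require Import structures.
Require Import Defs.
From mathcomp Require Import all_boot all_order all_algebra.
From mathcomp Require Import generic_quotient ring_quotient.
From mathcomp Require Import boolp classical_sets reals.
From mathcomp Require Import mpoly monalg ring.

Set Implicit Arguments.
Unset Strict Implicit.
Unset Printing Implicit Defensive.

Import GRing.Theory.
Local Open Scope classical_set_scope.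
Local Open Scope ring_scope.

(** * Quotients by ideals *)

(** The unit ideal is included, so a quotient may be the zero ring; hence the [comPzRingType]
    structures below. *)
Record ideal (R : comPzRingType) := Ideal {
  ideal_set :> R -> Prop;
  ideal0 : ideal_set 0;
  idealD : forall x y, ideal_set x -> ideal_set y -> ideal_set (x + y);
  idealMl : forall a x, ideal_set x -> ideal_set (a * x) }.

Section Ideals.
Variables (R : comPzRingType).
Implicit Type I : ideal R.

Lemma idealN I x : I x -> I (- x).
Proof. by rewrite -mulN1r; apply: idealMl. Qed.

Lemma idealB I x y : I x -> I y -> I (x - y).
Proof. by move=> Ix Iy; apply/idealD/idealN. Qed.

Lemma ideal_sum I (T : finType) (F : T -> R) :
  (forall i, I (F i)) -> I (\sum_i F i).
Proof.
move=> IF; elim/big_rec: _ => [|i x _]; first exact: ideal0.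
exact: idealD.
Qed.

Section Span.
Variables (T : finType) (r : T -> R).

Let span (p : R) := exists c : T -> R, p = \sum_i c i * r i.

Fact span0 : span 0.
Proof. by exists (fun=> 0); rewrite big1 // => i _; rewrite mul0r. Qed.
Fact spanD x y : span x -> span y -> span (x + y).
Proof.
move=> [c ->] [d ->]; exists (fun i => c i + d i).
by rewrite -big_split; apply: eq_bigr => i _; rewrite mulrDl.
Qed.
Fact spanMl a x : span x -> span (a * x).
Proof.
move=> [c ->]; exists (fun i => a * c i).
by rewrite mulr_sumr; apply: eq_bigr => i _; rewrite mulrA.
Qed.

Definition span_ideal : ideal R := Ideal span0 spanD spanMl.

Lemma span_mem i : span_ideal (r i).
Proof.
exists (fun j => (j == i)%:R); rewrite (bigD1 i) //= eqxx mul1r big1 ?addr0 //.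
by move=> j /negPf ->; rewrite mul0r.
Qed.

Lemma span_sub I : (forall i, I (r i)) -> forall x, span_ideal x -> I x.
Proof. by move=> Ir _ [c ->]; apply: ideal_sum => i; apply: idealMl. Qed.

End Span.

Section Kernel.
Variables (S : comPzRingType) (f : {rmorphism R -> S}).

Fact ker0 : f 0 = 0. Proof. exact: rmorph0. Qed.
Fact kerD x y : f x = 0 -> f y = 0 -> f (x + y) = 0.
Proof. by move=> fx fy; rewrite rmorphD fx fy addr0. Qed.
Fact kerMl a x : f x = 0 -> f (a * x) = 0.
Proof. by move=> fx; rewrite rmorphM fx mulr0. Qed.

Definition ker_ideal : ideal R :=
  @Ideal R (fun x => f x = 0) ker0 kerD kerMl.

End Kernel.

Section Quotient.
Variable I : ideal R.

Let mem : {pred R} := fun x => `[< I x >].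

Fact ideal_zmod_closed : zmod_closed mem.
Proof.
split=> [|x y /asboolP Ix /asboolP Iy]; apply/asboolP; first exact: ideal0.
exact: idealB.
Qed.
HB.instance Definition _ := GRing.isZmodClosed.Build R mem ideal_zmod_closed.

Definition quo : Type := Quotient.quot (mem : zmodClosed R).
HB.instance Definition _ := GRing.Zmodule.on quo.

Definition quo_proj : R -> quo := \pi_(Quotient.quot (mem : zmodClosed R))%qT.

Fact quo_proj_is_zmod_morphism : zmod_morphism quo_proj.
Proof. by move=> x y; rewrite /quo_proj -raddfB. Qed.
HB.instance Definition _ :=
  GRing.isZmodMorphism.Build R quo quo_proj quo_proj_is_zmod_morphism.

Lemma quo_proj_surj y : exists x, quo_proj x = y.
Proof. by exists (repr y); rewrite /quo_proj reprK. Qed.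

Lemma quo_proj_eq x y : quo_proj x = quo_proj y <-> I (x - y).
Proof.
rewrite /quo_proj; split=> [/eqP|Ixy].
  by rewrite -Quotient.idealrBE => /asboolP.
by apply/eqP; rewrite -Quotient.idealrBE; apply/asboolP.
Qed.

Let lift (y : quo) : R := sval (cid (quo_proj_surj y)).
Let liftK y : quo_proj (lift y) = y.
Proof. by rewrite /lift; case: cid. Qed.

Definition quo_one : quo := quo_proj 1.
Definition quo_mul (x y : quo) : quo := quo_proj (lift x * lift y).

Fact quo_projM x y : quo_proj (x * y) = quo_mul (quo_proj x) (quo_proj y).
Proof.
set x' := lift (quo_proj x); set y' := lift (quo_proj y).
have Ix : I (x - x') by apply/quo_proj_eq; rewrite liftK.
have Iy : I (y - y') by apply/quo_proj_eq; rewrite liftK.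
apply/quo_proj_eq.
have -> : x * y - x' * y' = y * (x - x') + x' * (y - y') by ring.
by apply: idealD; apply: idealMl.
Qed.

Fact quo_mulA : associative quo_mul.
Proof.
move=> x y z; rewrite -[x]liftK -[y]liftK -[z]liftK.
by rewrite -!quo_projM mulrA.
Qed.
Fact quo_mulC : commutative quo_mul.
Proof. by move=> x y; rewrite /quo_mul mulrC. Qed.
Fact quo_mul1 : left_id quo_one quo_mul.
Proof. by move=> x; rewrite -[x]liftK -quo_projM mul1r. Qed.
Fact quo_mulDl : left_distributive quo_mul +%R.
Proof.
move=> x y z; rewrite -[x]liftK -[y]liftK -[z]liftK.
by rewrite -raddfD -!quo_projM mulrDl raddfD.
Qed.

HB.instance Definition _ := GRing.Zmodule_isComPzRing.Build quo
  quo_mulA quo_mulC quo_mul1 quo_mulDl.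

Fact quo_proj_is_monoid_morphism : monoid_morphism quo_proj.
Proof. by split=> // x y; apply: quo_projM. Qed.
HB.instance Definition _ :=
  GRing.isMonoidMorphism.Build R quo quo_proj quo_proj_is_monoid_morphism.

Lemma quo_proj_eq0 x : quo_proj x = 0 <-> I x.
Proof. by rewrite -(raddf0 quo_proj) quo_proj_eq subr0. Qed.

End Quotient.

End Ideals.

(** Compose [f] with a set-theoretic section of [pi]: two preimages of a point differ by an element
    that [f] kills, so the composite respects sums and products. *)
Lemma surj_factor (R Q S : comPzRingType)
    (pi : {rmorphism R -> Q}) (f : {rmorphism R -> S}) :
  (forall y, exists x, pi x = y) -> (forall x, pi x = 0 -> f x = 0) ->
  exists h : {rmorphism Q -> S}, forall x, h (pi x) = f x.
Proof.
move=> /choice[s sK] fker.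
have fs x : f (s (pi x)) = f x.
  apply/eqP; rewrite -subr_eq0 -rmorphB; apply/eqP/fker.
  by rewrite rmorphB /= sK subrr.
have sB : zmod_morphism (f \o s).
  by move=> x y; rewrite -[x]sK -[y]sK /= -rmorphB !fs rmorphB.
have sM : monoid_morphism (f \o s).
  split=> [|x y]; first by rewrite /= -(rmorph1 pi) fs rmorph1.
  by rewrite /= -[x]sK -[y]sK -rmorphM !fs rmorphM.
pose ha := GRing.isZmodMorphism.Build _ _ (f \o s) sB.
pose hm := GRing.isMonoidMorphism.Build _ _ (f \o s) sM.
pose h : {rmorphism Q -> S} := HB.pack (f \o s) ha hm.
by exists h.
Qed.

(** * Finite presentation *)

Lemma mpoly_lift n (A : comNzRingType) (S : comPzRingType)
    (f : {rmorphism A -> S}) (h : 'I_n -> S) :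
  exists F : {rmorphism mpoly n A -> S},
    (forall c, F (mpolyC n c) = f c) /\ (forall i, F (mpolyX A (mnm1 i)) = h i).
Proof.
(* In the zero ring the zero map is a morphism with any prescribed values; otherwise [S] gets its
   nonzero structure and polynomial evaluation applies. *)
have [S10|S10] := eqVneq (1 : S) 0.
  have S0 (x y : S) : x = y.
    by rewrite -[x]mul1r -[y]mul1r S10 !mul0r.
  pose z (p : mpoly n A) : S := 0.
  have za : zmod_morphism z by move=> x y; apply: S0.
  have zm : monoid_morphism z by split=> [|x y]; apply: S0.
  pose ha := GRing.isZmodMorphism.Build _ _ z za.
  pose hm := GRing.isMonoidMorphism.Build _ _ z zm.
  pose F : {rmorphism mpoly n A -> S} := HB.pack z ha hm.
  by exists F; split=> *; apply: S0.
pose nz := GRing.PzSemiRing_isNonZero.Build S S10.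
pose S' : comNzRingType := HB.pack S nz.
pose fS : {rmorphism A -> S'} := f.
exists (mpoly.mmap fS h : {rmorphism mpoly n A -> S'}).
split=> u; first exact: (@mpoly.mmapC n A S' h fS).
by rewrite -[RHS](@mpoly.mmap1U n S' h u) -(@mpoly.mmapX n A S' h fS).
Qed.

Lemma mpoly_ext n (A : comNzRingType) (S : comPzRingType)
    (F G : {rmorphism mpoly n A -> S}) :
  (forall c, F (mpolyC n c) = G (mpolyC n c)) ->
  (forall i, F (mpolyX A (mnm1 i)) = G (mpolyX A (mnm1 i))) -> F =1 G.
Proof.
move=> FGC FGX p; rewrite (mpolyE p) !raddf_sum; apply: eq_bigr => m _.
rewrite -mul_mpolyC /= !rmorphM /= FGC mpolyXE_id !rmorph_prod; congr (_ * _).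
by apply: eq_bigr => i _; rewrite !rmorphXn /= FGX.
Qed.

(** The relations are indexed by any finite type, so that sums and options can serve to adjoin new
    ones. *)
Lemma finitely_presented_ker n (U : finType) (A : comNzRingType)
    (B : comPzRingType) (f : {rmorphism A -> B})
    (F : {rmorphism mpoly n A -> B}) (r : U -> mpoly n A) :
  (forall c, F (mpolyC n c) = f c) -> (forall y, exists p, F p = y) ->
  (forall i, F (r i) = 0) -> (forall p, F p = 0 -> span_ideal r p) ->
  finitely_presented f.
Proof.
move=> FC Fs Fr Fker; exists n, F, #|U|, (fun i => r (enum_val i)).
split=> // p; split=> [/Fker[c ->]|[c ->]]; last first.
  by rewrite rmorph_sum big1 // => i _; rewrite rmorphM /= Fr mulr0.
exists (fun i => c (enum_val i)).
by rewrite -(@big_enum_val _ _ _ U U (fun i => c i * r i)); apply: eq_bigl.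
Qed.

(* The section [s] identifies [B] with [A[X]/(r)]. *)
Lemma finitely_presented_section n (U : finType) (A : comNzRingType)
    (B : comPzRingType) (f : {rmorphism A -> B})
    (F : {rmorphism mpoly n A -> B}) (r : U -> mpoly n A)
    (s : {rmorphism B -> quo (span_ideal r)}) :
  (forall c, F (mpolyC n c) = f c) -> (forall y, exists p, F p = y) ->
  (forall i, F (r i) = 0) ->
  (forall c, s (f c) = quo_proj (span_ideal r) (mpolyC n c)) ->
  (forall i, s (F (mpolyX A (mnm1 i))) =
             quo_proj (span_ideal r) (mpolyX A (mnm1 i))) ->
  finitely_presented f.
Proof.
move=> FC Fs Fr sC sX; apply: (finitely_presented_ker FC Fs Fr) => p Fp0.
apply/quo_proj_eq0; have <- : s (F p) = quo_proj (span_ideal r) p.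
  apply: (mpoly_ext (F := s \o F) (G := quo_proj (span_ideal r))) => //= c.
  by rewrite FC sC.
by rewrite Fp0 rmorph0.
Qed.

Lemma finitely_presented_quotient (A : comNzRingType) (B C : comPzRingType)
    (f : {rmorphism A -> B}) (g : {rmorphism B -> C})
    (T : finType) (h : T -> B) :
  finitely_presented f -> (forall y, exists x, g x = y) ->
  (forall x, g x = 0 <-> span_ideal h x) -> finitely_presented (g \o f).
Proof.
move=> [n [F [m [r [FC Fs Fker]]]]] gs gker.
have [h' Fh'] := choice (fun t => Fs (h t)).
(* The relations of [B], together with lifts of the generators of the kernel of [g]. *)
pose r' (i : 'I_m + T) := match i with inl i => r i | inr t => h' t end.
apply: (@finitely_presented_ker n _ _ _ _ (g \o F) r').
- by move=> c /=; rewrite FC.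
- move=> y; have [x <-] := gs y; have [p <-] := Fs x.
  by exists p.
- case=> [i|t] /=; last by rewrite Fh'; apply/gker/span_mem.
  suff -> : F (r i) = 0 by rewrite rmorph0.
  by apply/Fker; apply: (span_mem r i).
- move=> p gFp; have /gker[c Fp] : g (F p) = 0 by [].
  have [c' Fc'] := choice (fun t => Fs (c t)).
  have /Fker[d pE] : F (p - \sum_t c' t * h' t) = 0.
    rewrite rmorphB Fp rmorph_sum /=; apply/eqP; rewrite subr_eq0; apply/eqP.
    by apply: eq_bigr => t _; rewrite rmorphM /= Fc' Fh'.
  rewrite -[p](subrK (\sum_t c' t * h' t)) pE; apply: idealD.
    by apply: ideal_sum => i; apply: idealMl; apply: (span_mem r' (inl i)).
  by apply: ideal_sum => t; apply: idealMl; apply: (span_mem r' (inr t)).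
Qed.

(* The relations of any presentation of [B], evaluated at preimages in [A] of
   the generators, generate the kernel. *)
Lemma finitely_presented_surj_ker (A : comNzRingType) (B : comPzRingType)
    (f : {rmorphism A -> B}) :
  finitely_presented f -> (forall y, exists x, f x = y) ->
  exists m (h : 'I_m -> A), forall x, f x = 0 <-> span_ideal h x.
Proof.
move=> [n [F [m [r [FC Fs Fker]]]]] fs.
have [a fa] := choice (fun i => fs (F (mpolyX A (mnm1 i)))).
have [G [GC GX]] := mpoly_lift idfun a.
have fG p : f (G p) = F p.
  apply: (mpoly_ext (F := f \o G) (G := F)) => [c|i] /=.
    by rewrite GC FC.
  by rewrite GX fa.
exists m, (G \o r) => x; split=> [fx|].
  have /Fker[c cE] : F (mpolyC n x) = 0 by rewrite FC.
  exists (G \o c); have := congr1 G cE; rewrite GC /= => ->.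
  by rewrite rmorph_sum; apply: eq_bigr => i _; rewrite rmorphM.
apply: (span_sub (I := ker_ideal f)) => i /=; rewrite fG.
by apply/Fker; apply: (span_mem r i).
Qed.

(** * Localization *)

Section Localization.
Variables (B : comPzRingType) (g : B).

(** The localization is built as B[X]/(gX - 1), where B[X] is the monoid algebra of the naturals and
    [t] is gX. *)
Let P := monoid_alg B nat.
Let t : P := mterm g 1%N.
Let I : ideal P := span_ideal (fun _ : unit => t - 1).
Let l : {rmorphism B -> quo I} := quo_proj I \o mconst nat.

Let natD1 (u : nat) : (u + 1%N)%R = u.+1 :> nat. Proof. exact: addn1. Qed.

Let mcoeff_mult c n :
  mcoeff n (c * t) = if n is n'.+1 then mcoeff n' c * g else 0.
Proof.
elim/ma_ind: c => [|b u c IH].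
  by rewrite mul0r; case: n => [|n]; rewrite !mcoeff0 ?mul0r.
rewrite mulrDl mcoeffD IH mtermM mcoeff_mterm natD1.
case: n {IH} => [|n].
  by rewrite addr0.
by rewrite mcoeffD mcoeff_mterm mulrDl mulrnAl eqSS.
Qed.

Let mcoeff_eventually0 (c : P) :
  exists n, forall m, (n <= m)%N -> mcoeff m c = 0.
Proof.
elim/ma_ind: c => [|b u c [n nP]]; first by exists 0%N => m _; rewrite mcoeff0.
exists (maxn n u.+1) => m; rewrite geq_max => /andP[nm um].
by rewrite mcoeffD nP // mcoeff_mterm (ltn_eqF um) addr0.
Qed.

Lemma localization_exists :
  exists (Bg : comPzRingType) (l : {rmorphism B -> Bg}), is_localization g l.
Proof.
pose x : quo I := quo_proj I (mexp B 1%N).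
have lgx : l g * x = 1.
  rewrite /l /x /= -rmorphM mtermM mulr1 add0r -(rmorph1 (quo_proj I)).
  by apply/quo_proj_eq; apply: (span_mem (fun _ : unit => t - 1) tt).
exists (quo I), l; split.
- by exists x.
(* If b = c (gX - 1), comparing coefficients gives c_n = - g^n b for every n. As [c] has finite
   support, some g^n kills b. *)
- move=> b /= /quo_proj_eq0[c bE].
  have {}bE : mconst nat b = c tt * t - c tt.
    by rewrite bE (big_pred1 tt) ?mulrBr ?mulr1 //; case.
  have cE n : mcoeff n (c tt) = - (g ^+ n * b).
    elim: n => [|n IHn].
      have := congr1 (mcoeff 0%N) bE.
      rewrite mcoeffB mcoeff_mult sub0r mcoeff_mterm => bE0.
      by rewrite mul1r -[b]/(b *+ 1) bE0 opprK.
    have := congr1 (mcoeff n.+1) bE.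
    rewrite mcoeffB mcoeff_mult mcoeff_mterm => /esym/eqP.
    by rewrite subr_eq0 IHn => /eqP <-; rewrite exprSr mulNr mulrAC.
  have [n nP] := mcoeff_eventually0 (c tt).
  by exists n; apply/eqP; rewrite -oppr_eq0 -cE nP.
- move=> y; have [p <-] := quo_proj_surj y.
  elim/ma_ind: p => [|b u p [b' [n IH]]].
    by exists 0, 0%N; rewrite !rmorph0 mulr0.
  (* The class x of X inverts g, so g^(n+u) (b x^u + p) = g^n b + g^u b'. *)
  exists (g ^+ n * b + g ^+ u * b'), (n + u)%N.
  have -> : mterm b u = mconst nat b * mexp B 1%N ^+ u :> P.
    elim: u => [|u IHu]; first by rewrite mulr1.
    by rewrite exprSr mulrA -IHu mtermM mulr1 natD1.
  rewrite 2!rmorphD 2!rmorphM !rmorphXn /= -/(l b) -/x mulrDr; congr (_ + _).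
    rewrite rmorphM rmorphXn exprD mulrACA -exprMn.
    by have -> : quo_proj I (mconst nat g) * quo_proj I (mexp B 1%N) = 1;
      rewrite ?expr1n ?mulr1.
  by rewrite addnC exprD -mulrA IH.
Qed.

End Localization.

Lemma localization_lift (B Bg E : comPzRingType) (g : B)
    (l : {rmorphism B -> Bg}) (h : {rmorphism B -> E}) (v : E) :
  is_localization g l -> h g * v = 1 ->
  exists h' : {rmorphism Bg -> E}, forall x, h' (l x) = h x.
Proof.
move=> [_ lker lfrac] gv.
have gvn n : h g ^+ n * v ^+ n = 1 by rewrite -exprMn gv expr1n.
have /choice[s sE] y : exists xn : B * nat, l g ^+ xn.2 * y = l xn.1.
  by have [x [n ?]] := lfrac y; exists (x, n).
pose H y := h (s y).1 * v ^+ (s y).2.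
(* Every fraction x / g^n for [y] gives the same value: two of them agree in [B] after
   multiplication by powers of [g], which become invertible in [E]. *)
have HE y x n : l g ^+ n * y = l x -> H y = h x * v ^+ n.
  move=> yE; set m := (s y).2; set x' := (s y).1.
  have /lker[p] : l (g ^+ m * x - g ^+ n * x') = 0.
    by rewrite rmorphB !rmorphM !rmorphXn -yE -sE mulrCA subrr.
  move/(congr1 (fun z => h z * v ^+ p)).
  rewrite rmorphM rmorphXn mulrAC gvn mul1r rmorph0 mul0r rmorphB => /eqP.
  rewrite subr_eq0 !rmorphM !rmorphXn => /eqP e.
  transitivity (h x' * v ^+ m * (h g ^+ n * v ^+ n)).
    by rewrite gvn mulr1.
  transitivity (h x * v ^+ n * (h g ^+ m * v ^+ m)); last by rewrite gvn mulr1.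
  transitivity (h g ^+ n * h x' * (v ^+ m * v ^+ n)); first by ring.
  by rewrite -e; ring.
have HB : zmod_morphism H.
  move=> y z; rewrite (HE (y - z) (g ^+ (s z).2 * (s y).1 - g ^+ (s y).2 * (s z).1)
    ((s y).2 + (s z).2)%N); last first.
    by rewrite rmorphB !rmorphM !rmorphXn -!sE exprD; ring.
  rewrite rmorphB !rmorphM !rmorphXn exprD mulrBl /H; congr (_ - _).
    by rewrite -[RHS]mulr1 -(gvn (s z).2); ring.
  by rewrite mulrACA gvn mul1r.
have HM : monoid_morphism H.
  split=> [|y z]; first by rewrite (HE 1 1 0%N) ?rmorph1 ?mul1r.
  rewrite (HE _ ((s y).1 * (s z).1) ((s y).2 + (s z).2)%N).
    by rewrite rmorphM exprD mulrACA.
  by rewrite rmorphM -!sE exprD mulrACA.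
pose ha := GRing.isZmodMorphism.Build _ _ H HB.
pose hm := GRing.isMonoidMorphism.Build _ _ H HM.
pose h' : {rmorphism Bg -> E} := HB.pack H ha hm.
by exists h' => x; rewrite [LHS](HE _ x 0%N) ?mulr1 ?mul1r.
Qed.

Lemma localization_ext (B Bg E : comPzRingType) (g : B)
    (l : {rmorphism B -> Bg}) (F G : {rmorphism Bg -> E}) :
  is_localization g l -> (forall x, F (l x) = G (l x)) -> F =1 G.
Proof.
move=> [[h gh] _ lfrac] FG y; have [x [n yE]] := lfrac y.
have -> : y = l x * h ^+ n by rewrite -yE mulrAC -exprMn gh expr1n mul1r.
rewrite !rmorphM !rmorphXn FG; congr (_ * _ ^+ _).
have Gg : G (l g) * G h = 1 by rewrite -rmorphM gh rmorph1.
rewrite -[F h]mulr1 -Gg mulrA -FG -rmorphM [h * _]mulrC gh rmorph1.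
by rewrite mul1r.
Qed.

(** Adjoin to a presentation of [B] a variable Z and the relation g' Z = 1, where g' lifts [g]. *)
Lemma finitely_presented_localization (A : comNzRingType)
    (B Bg : comPzRingType) (f : {rmorphism A -> B}) (g : B)
    (l : {rmorphism B -> Bg}) :
  finitely_presented f -> is_localization g l ->
  finitely_presented (l \o f).
Proof.
move=> [n [F [m [r [FC Fs Fker]]]]] locl.
have [[h gh] _ lfrac] := locl.
have [g' Fg'] := Fs g.
(* [W] sends the old variables to the first [n] of the new ones; the last variable stands for the
   inverse of [g]. *)
have [W [WC WX]] := mpoly_lift (@mpolyC n.+1 A)
  (fun i : 'I_n => mpolyX A (mnm1 (lift ord_max i))).
pose Z : mpoly n.+1 A := mpolyX A (mnm1 ord_max).
have [G [GC GX]] := mpoly_lift (l \o f)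
  (fun i : 'I_n.+1 => if unlift ord_max i is Some j
                      then l (F (mpolyX A (mnm1 j))) else h).
have GW p : G (W p) = l (F p).
  apply: (mpoly_ext (F := G \o W) (G := l \o F)) => [c|i] /=.
    by rewrite WC GC FC.
  by rewrite WX GX liftK.
have GZ : G Z = h by rewrite GX unlift_none.
pose r' (i : option 'I_m) := if i is Some j then W (r j) else W g' * Z - 1.
pose pi := quo_proj (span_ideal r').
have [s sF] : exists s : {rmorphism B -> quo (span_ideal r')},
    forall p, s (F p) = pi (W p).
  apply: (@surj_factor _ _ _ F (pi \o W)) => // p /Fker[c ->] /=.
  rewrite !rmorph_sum big1 // => i _; rewrite !rmorphM /=.
  have /quo_proj_eq0 -> := span_mem r' (Some i); exact: mulr0.
have sgZ : s g * pi Z = 1.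
  rewrite -Fg' sF -rmorphM -(rmorph1 pi).
  by apply/quo_proj_eq; apply: (span_mem r' None).
have [s' s'l] := localization_lift locl sgZ.
apply: (@finitely_presented_section n.+1 _ _ _ _ G r' s') => //.
- move=> y; have [x [k yE]] := lfrac y; have [p pE] := Fs x.
  exists (W p * Z ^+ k).
  by rewrite rmorphM rmorphXn GW GZ pE -yE mulrAC -exprMn gh expr1n mul1r.
- case=> [i|] /=.
    by rewrite GW; have -> : F (r i) = 0; rewrite ?rmorph0 //;
      apply/Fker; apply: (span_mem r i).
  by rewrite rmorphB rmorphM rmorph1 GW GZ Fg' gh subrr.
- by move=> c /=; rewrite s'l -FC sF WC.
- move=> i; case: (unliftP ord_max i) => [j ->|->].
    by rewrite -WX GW s'l sF.
  rewrite GZ -[s' h]mul1r -sgZ mulrAC -s'l.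
  by rewrite -(rmorphM s') gh rmorph1 mul1r.
Qed.

(** * Square-zero extensions *)

(** Integer powers of a unit [x] whose inverse [y] is carried as data, which makes them compatible
    with all ring morphisms. [Negz n] is -(n+1), whence the exponent. *)
Definition zpow (E : comPzRingType) (x y : E) (z : int) : E :=
  match z with Posz n => x ^+ n | Negz n => y ^+ n.+1 end.

Section Zpow.
Variables (E : comPzRingType) (x y : E).
Hypothesis xy : x * y = 1.

Lemma zpow_sub (m n : nat) : zpow x y (m%:Z - n%:Z) = x ^+ m * y ^+ n.
Proof.
have xyn k : x ^+ k * y ^+ k = 1 by rewrite -exprMn xy expr1n.
case: (leqP n m) => [/subnK <-|/subnK <-].
  by rewrite PoszD addrK /= exprD -mulrA xyn mulr1.
have -> : m%:Z - (n - m.+1 + m.+1)%N%:Z = Negz (n - m.+1).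
  by rewrite addnS -addSn PoszD opprD addrCA subrr addr0 NegzE.
by rewrite /= addnS -addSn exprD mulrCA xyn mulr1.
Qed.

Lemma zpowD z z' : zpow x y (z + z') = zpow x y z * zpow x y z'.
Proof.
have zE (w : int) : exists m n : nat, w = m%:Z - n%:Z.
  by case: w => n; [exists n, 0%N; rewrite subr0|exists 0%N, n.+1; rewrite sub0r].
have [m [n ->]] := zE z; have [m' [n' ->]] := zE z'.
by rewrite addrACA -opprD -!PoszD !zpow_sub !exprD mulrACA.
Qed.

End Zpow.

Lemma rmorph_zpow (E E' : comPzRingType) (f : {rmorphism E -> E'}) x y z :
  f (zpow x y z) = zpow (f x) (f y) z.
Proof. by case: z => n; apply: rmorphXn. Qed.

Lemma inverse_unique (E : comPzRingType) (x y z : E) :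
  x * y = 1 -> x * z = 1 -> y = z.
Proof. by move=> xy xz; rewrite -[y]mulr1 -xz mulrCA mulrA xy mul1r. Qed.

Definition square_zero (E E' : comPzRingType) (pi : {rmorphism E -> E'}) :=
  forall x y, pi x = 0 -> pi y = 0 -> x * y = 0.

Lemma square_zero_inverse (E E' : comPzRingType) (pi : {rmorphism E -> E'}) :
  (forall y, exists x, pi x = y) -> square_zero pi ->
  forall x u, pi x * u = 1 -> exists2 y, x * y = 1 & pi y = u.
Proof.
move=> pis pi0 x u xu; have [y yu] := pis u.
have z0 : pi (1 - x * y) = 0 by rewrite rmorphB rmorphM rmorph1 yu xu subrr.
(* One Newton step: with e = 1 - xy and e^2 = 0, the product xy (2 - xy) is 1 - e^2. *)
have xy : x * (y * (2%:R - x * y)) = 1.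
  have := pi0 _ _ z0 z0 => /eqP; rewrite -subr_eq0 => /eqP E0.
  apply/eqP; rewrite -subr_eq0 -oppr_eq0 -E0; apply/eqP; ring.
exists (y * (2%:R - x * y)) => //.
by apply: (inverse_unique _ xu); rewrite -rmorphM xy rmorph1.
Qed.

(** The ring B[eps] with eps^2 = 0, the pair (a, b) being a + b eps; its morphisms encode
    derivations. *)
Definition dual_number (B : comPzRingType) : Type := (B * B)%type.

Section DualNumber.
Variable B : comPzRingType.

HB.instance Definition _ := GRing.Zmodule.on (dual_number B).

Definition dual_one : dual_number B := (1, 0).
Definition dual_mul (x y : dual_number B) : dual_number B :=
  (x.1 * y.1, x.1 * y.2 + y.1 * x.2).

Fact dual_mulA : associative dual_mul.
Proof. by move=> [a b] [c d] [e f]; congr pair; rewrite /=; ring. Qed.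
Fact dual_mulC : commutative dual_mul.
Proof. by move=> [a b] [c d]; congr pair; rewrite /=; ring. Qed.
Fact dual_mul1 : left_id dual_one dual_mul.
Proof. by move=> [a b]; congr pair; rewrite /=; ring. Qed.
Fact dual_mulDl : left_distributive dual_mul +%R.
Proof. by move=> [a b] [c d] [e f]; congr pair; rewrite /=; ring. Qed.

HB.instance Definition _ := GRing.Zmodule_isComPzRing.Build (dual_number B)
  dual_mulA dual_mulC dual_mul1 dual_mulDl.

Definition dual_const (b : B) : dual_number B := (b, 0).

Fact dual_const_is_zmod_morphism : zmod_morphism dual_const.
Proof. by move=> x y; congr pair; rewrite subr0. Qed.
Fact dual_const_is_monoid_morphism : monoid_morphism dual_const.
Proof. by split=> // x y; congr pair; rewrite /=; ring. Qed.
HB.instance Definition _ := GRing.isZmodMorphism.Build B (dual_number B)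
  dual_const dual_const_is_zmod_morphism.
HB.instance Definition _ := GRing.isMonoidMorphism.Build B (dual_number B)
  dual_const dual_const_is_monoid_morphism.

End DualNumber.

(** * Split extensions of monoids by lattices *)

Lemma ma_ext (R S : comPzRingType) (K : nmodType)
    (F G : {rmorphism monoid_alg R K -> S}) :
  (forall c, F (mconst K c) = G (mconst K c)) ->
  (forall u, F (mexp R u) = G (mexp R u)) -> F =1 G.
Proof.
move=> FGc FGe; elim/ma_ind => [|c u x IH]; first by rewrite !rmorph0.
by rewrite !rmorphD mtermE !rmorphM FGc FGe IH.
Qed.

Lemma ma_reindex_term (R : comPzRingType) (K K' : nmodType)
    (f : {additive K -> K'}) c u :
  ma_reindex f (mterm c u) = mterm c (f u) :> monoid_alg R K'.
Proof.
by rewrite mtermE rmorphM /= ma_reindex_const ma_reindex_exp -mtermE.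
Qed.

(* The monoid [K] is the product of [j K0] and of the group generated by the
   [w i]; [cd] gives (possibly non-unique) coordinates of the second factor. *)
Record lattice_splitting (K0 K : nmodType) (j : {additive K0 -> K}) (n : nat) :=
  LatticeSplitting {
  split_proj : {additive K -> K0};
  split_coord : 'I_n -> K -> int;
  split_gen : 'I_n -> K;
  split_opp : 'I_n -> K;
  split_coordD : forall i u v,
    split_coord i (u + v) = split_coord i u + split_coord i v;
  split_projK : forall v, split_proj (j v) = v;
  split_coord_base : forall i v, split_coord i (j v) = 0;
  split_proj_gen : forall i, split_proj (split_gen i) = 0;
  split_genN : forall i, split_gen i + split_opp i = 0;
  split_decomp : forall (S : comPzRingType) (h : expMorphism K S) u,
    h u = h (j (split_proj u)) *
      \prod_i zpow (h (split_gen i)) (h (split_opp i)) (split_coord i u) }.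

Section LatticeExtension.
Variables (k : comNzRingType) (K0 K : nmodType) (j : {additive K0 -> K}).
Variables (n : nat) (sp : lattice_splitting j n).

Let A0 : comNzRingType := monoid_alg k K0.
Let A : comNzRingType := monoid_alg k K.
Let J : {rmorphism A0 -> A} := ma_reindex j.
Let JC c : J (mconst K0 c) = mconst K c. Proof. exact: ma_reindex_const. Qed.
Let Je u : J (mexp k u) = mexp k (j u). Proof. exact: ma_reindex_exp. Qed.
Let w := split_gen sp.
Let w' := split_opp sp.
Let pr := split_proj sp.
Let cd := split_coord sp.

Let cd0 i : cd i 0 = 0.
Proof.
have /eqP := split_coordD sp i 0 0.
by rewrite addr0 -subr_eq0 opprD addNKr oppr_eq0 => /eqP.
Qed.

Section Lift.
Variables (S : comPzRingType) (a : {rmorphism A0 -> S}) (x y : 'I_n -> S).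
Hypothesis xy : forall i, x i * y i = 1.

Let T u := \prod_i zpow (x i) (y i) (cd i u).

Let T0 : T 0 = 1.
Proof. by rewrite /T big1 // => i _; rewrite cd0. Qed.
Let TD u v : T (u + v) = T u * T v.
Proof.
by rewrite /T -big_split; apply: eq_bigr => i _; rewrite [cd _ _]split_coordD zpowD.
Qed.

Let H u := a (mexp k (pr u)) * T u.
Let H0 : H 0 = 1.
Proof. by rewrite /H raddf0 mexp0 rmorph1 mul1r. Qed.
Let HD u v : H (u + v) = H u * H v.
Proof. by rewrite /H raddfD mexpD rmorphM TD mulrACA. Qed.

(** Any choice of units [x i] gives a morphism, although the generators may satisfy relations: the
    value at a generator is the product read off from its coordinates, and need not be [x i]. *)
Lemma lattice_extension_lift :
  exists c : {rmorphism A -> S},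
    (forall z, c (J z) = a z) /\
    (forall u, c (mexp k u) =
       a (mexp k (split_proj sp u)) *
       \prod_i zpow (x i) (y i) (split_coord sp i u)).
Proof.
pose a' : {rmorphism k -> S} := a \o mconst K0.
pose c : {rmorphism A -> S} := ma_lift a' (ExpMorphism H0 HD).
have ce u : c (mexp k u) = H u by exact: (ma_lift_exp a' (ExpMorphism H0 HD)).
exists c; split=> [z|u]; last exact: ce.
apply: (ma_ext (F := c \o J)) z => [b|u] /=.
  by rewrite JC; apply: (ma_lift_const a' (ExpMorphism H0 HD)).
rewrite Je ce /H /pr split_projK /T big1 ?mulr1 // => i _.
by rewrite /cd split_coord_base.
Qed.

End Lift.

Lemma lattice_extension_ext (S : comPzRingType) (F G : {rmorphism A -> S}) :
  (forall z, F (J z) = G (J z)) -> (forall u, F (mexp k u) = G (mexp k u)) ->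
  F =1 G.
Proof.
move=> FGJ FGe; apply: ma_ext => // c.
by have := FGJ (mconst K0 c); rewrite JC.
Qed.

Let mexp_decomp (S : comPzRingType) (F : {rmorphism A -> S}) u :
  F (mexp k u) = F (J (mexp k (pr u))) *
     \prod_i zpow (F (mexp k (w i))) (F (mexp k (w' i))) (cd i u).
Proof.
have F0 : F (mexp k (0 : K)) = 1 by rewrite mexp0 rmorph1.
have FD (v v' : K) : F (mexp k (v + v')) = F (mexp k v) * F (mexp k v').
  by rewrite mexpD rmorphM.
rewrite Je.
exact: (split_decomp sp (ExpMorphism F0 FD)).
Qed.

Let mexp_genN i : mexp k (w i) * mexp k (w' i) = 1 :> A.
Proof. by rewrite -mexpD split_genN mexp0. Qed.

(** Lift the images of the units e^(w i) arbitrarily; a lift of a unit along a square-zero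
    surjection is a unit. The resulting morphism reduces to [b] because [mexp_decomp] holds for
    [b]. *)
Lemma lattice_extension_formally_smooth :
  formally_smooth (ma_reindex j : {rmorphism A0 -> A}).
Proof.
move=> E E' pi a b pis pi0 bJ.
have [x xE] := choice (fun i => pis (b (mexp k (w i)))).
have /choice[y yE] i : exists y, x i * y = 1 /\ pi y = b (mexp k (w' i)).
  have xb : pi (x i) * b (mexp k (w' i)) = 1.
    by rewrite xE -rmorphM mexp_genN rmorph1.
  by have [y ? ?] := square_zero_inverse pis pi0 xb; exists y.
have [c [cJ ce]] := lattice_extension_lift a (fun i => (yE i).1).
exists c; split=> //.
apply: (lattice_extension_ext (F := pi \o c)) => [z|u] /=.
  by rewrite cJ -bJ.
rewrite ce rmorphM -bJ mexp_decomp rmorph_prod; congr (_ * _).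
by apply: eq_bigr => i _; rewrite rmorph_zpow xE (yE i).2.
Qed.

Lemma lattice_extension_finitely_presented :
  finitely_presented (ma_reindex j : {rmorphism A0 -> A}).
Proof.
pose X i : mpoly (n + n) A0 := mpolyX A0 (mnm1 (lshift n i)).
pose Y i : mpoly (n + n) A0 := mpolyX A0 (mnm1 (rshift n i)).
have [F [FC FXY]] := mpoly_lift J (fun i : 'I_(n + n) =>
  match fintype.split i with inl i => mexp k (w i) | inr i => mexp k (w' i) end).
have FX i : F (X i) = mexp k (w i) by rewrite FXY (unsplitK (inl i)).
have FY i : F (Y i) = mexp k (w' i) by rewrite FXY (unsplitK (inr i)).
(* The first family makes Y_i inverse to X_i; the second expresses each generator through its own
   coordinates and so accounts for the redundancy among generators. *)
pose r (i : 'I_n + 'I_n) := match i with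
  | inl i => X i * Y i - 1
  | inr l => X l - \prod_i zpow (X i) (Y i) (cd i (w l))
  end.
pose pi : {rmorphism _ -> quo _} := quo_proj (span_ideal r).
have xy i : pi (X i) * pi (Y i) = 1.
  rewrite -rmorphM -(rmorph1 pi).
  by apply/quo_proj_eq; apply: (span_mem r (inl i)).
have xE l : pi (X l) = \prod_i zpow (pi (X i)) (pi (Y i)) (cd i (w l)).
  transitivity (pi (\prod_i zpow (X i) (Y i) (cd i (w l)))).
    by apply/quo_proj_eq; apply: (span_mem r (inr l)).
  by rewrite rmorph_prod; apply: eq_bigr => i _; rewrite rmorph_zpow.
have [s [sJ se]] := lattice_extension_lift
  (pi \o @mpolyC (n + n) A0 : {rmorphism A0 -> quo (span_ideal r)}) xy.
have sw l : s (mexp k (w l)) = pi (X l).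
  by rewrite se /= split_proj_gen mexp0 !rmorph1 mul1r -xE.
have sw' l : s (mexp k (w' l)) = pi (Y l).
  apply: (inverse_unique (x := pi (X l))) => //.
  by rewrite -sw -rmorphM mexp_genN rmorph1.
apply: (@finitely_presented_section _ _ _ _ _ F r s) => //.
- elim/ma_ind => [|c u z [p IH]]; first by exists 0; rewrite rmorph0.
  exists (mpolyC (n + n) (mterm c (pr u)) *
          \prod_i zpow (X i) (Y i) (cd i u) + p).
  rewrite rmorphD IH rmorphM FC; congr (_ + _).
  rewrite rmorph_prod !mtermE rmorphM -mulrA.
  rewrite [mexp k u](mexp_decomp idfun u) /= JC; congr (_ * (_ * _)).
  by apply: eq_bigr => i _; rewrite rmorph_zpow FX FY.
- case=> [i|l]; rewrite rmorphB.
    by rewrite rmorphM FX FY mexp_genN rmorph1 subrr.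
  rewrite FX rmorph_prod [mexp k (w l)](mexp_decomp idfun (w l)) /= /pr split_proj_gen.
  rewrite mexp0 rmorph1 mul1r; apply/eqP; rewrite subr_eq0; apply/eqP.
  by apply: eq_bigr => i _; rewrite rmorph_zpow FX FY.
- move=> i; case: (split_ordP i) => l ->.
    by rewrite -/(X l) FX.
  by rewrite -/(Y l) FY.
Qed.

End LatticeExtension.

(** * Composition and pointwise equality for the smoothness conditions *)

Lemma formally_smooth_comp (A B C : comPzRingType) (f : {rmorphism A -> B})
    (g : {rmorphism B -> C}) :
  formally_smooth f -> formally_smooth g -> formally_smooth (g \o f).
Proof.
move=> fs gs E E' pi a b pis pi0 bgf.
have [c [cf cb]] := fs E E' pi a (b \o g) pis pi0 bgf.
have [d [dg db]] := gs E E' pi c b pis pi0 (fun x => esym (cb x)).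
by exists d; split=> // x; rewrite /= dg cf.
Qed.

Lemma finitely_presented_ext (A : comNzRingType) (B : comPzRingType)
    (f g : {rmorphism A -> B}) :
  f =1 g -> finitely_presented f -> finitely_presented g.
Proof.
move=> fg [n [F [m [r [FC Fs Fker]]]]].
by exists n, F, m, r; split=> // c; rewrite FC.
Qed.

Lemma formally_smooth_ext (A B : comPzRingType) (f g : {rmorphism A -> B}) :
  f =1 g -> formally_smooth f -> formally_smooth g.
Proof.
move=> fg fs E E' pi a b pis pi0 bg.
have [|c [cf cb]] := fs E E' pi a b pis pi0; first by move=> x; rewrite fg.
by exists c; split=> // x; rewrite -fg.
Qed.

(** * Derivations from formal smoothness *)

Section Augmentation.
Variables (B : comPzRingType) (M : zmodType).

Let C : comPzRingType := monoid_alg B M.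

Fact aug_exp0 : 1 = 1 :> B. Proof. by []. Qed.
Fact aug_expD (u v : M) : 1 = 1 * 1 :> B. Proof. by rewrite mulr1. Qed.

(** The comorphism of the unit section of the torus over Spec B. *)
Definition aug : C -> B := ma_lift idfun (ExpMorphism aug_exp0 aug_expD).
HB.instance Definition _ := GRing.RMorphism.copy aug
  (ma_lift idfun (ExpMorphism aug_exp0 aug_expD)).

Lemma aug_const b : aug (mconst M b) = b.
Proof. exact: (ma_lift_const idfun (ExpMorphism aug_exp0 aug_expD)). Qed.
Lemma aug_exp u : aug (mexp B u) = 1.
Proof. exact: (ma_lift_exp idfun (ExpMorphism aug_exp0 aug_expD)). Qed.

Lemma rmorph_aug (S : comPzRingType) (F : {rmorphism C -> S}) :
  (forall u, F (mexp B u) = 1) -> forall x, F x = F (mconst M (aug x)).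
Proof.
move=> Fe; apply: (ma_ext (G := (F \o mconst M) \o aug)) => [c|u] /=.
  by rewrite aug_const.
by rewrite Fe aug_exp !rmorph1.
Qed.

Section Basis.
Variables (n : nat) (beta : 'I_n -> M).
Hypothesis beta_span : forall u, exists z : 'I_n -> int,
  u = \sum_i beta i *~ z i.

Lemma rmorph_exp1 (S : comPzRingType) (F : {rmorphism C -> S}) :
  (forall i, F (mexp B (beta i)) = 1) -> forall u, F (mexp B u) = 1.
Proof.
move=> Fb u; have [z ->] := beta_span u.
have FN v : F (mexp B v) = 1 -> F (mexp B (- v)) = 1.
  by move=> Fv; rewrite -[LHS]mul1r -Fv -rmorphM -mexpD subrr mexp0 rmorph1.
elim/big_rec: _ => [|i v _ IH]; first by rewrite mexp0 rmorph1.
rewrite mexpD rmorphM IH mulr1.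
have Fn m : F (mexp B (beta i *+ m)) = 1.
  elim: m => [|m IHm]; first by rewrite mexp0 rmorph1.
  by rewrite mulrSr mexpD rmorphM IHm Fb mulr1.
by case: (z i) => m; [exact: Fn|apply: FN; exact: Fn].
Qed.

(** Modulo the elements e^(beta i) - 1 every e^u becomes 1, so the quotient map factors through
    [aug]. Finite generation of this kernel later makes [rho] finitely presented. *)
Lemma aug_ker x :
  aug x = 0 <-> span_ideal (fun i => mexp B (beta i) - 1) x.
Proof.
split=> [x0|]; last first.
  apply: (span_sub (I := ker_ideal aug)) => i.
  by change (aug (mexp B (beta i) - 1) = 0); rewrite rmorphB rmorph1 /= aug_exp subrr.
pose pi : {rmorphism C -> quo _} :=
  quo_proj (span_ideal (fun i => mexp B (beta i) - 1)).
apply/quo_proj_eq0; rewrite (rmorph_aug (F := pi)) ?x0 ?rmorph0 //.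
apply: rmorph_exp1 => i; rewrite -(rmorph1 pi).
by apply/quo_proj_eq; apply: (span_mem (fun i => mexp B (beta i) - 1)).
Qed.

End Basis.

Section Jet.
Variable lambda : {additive M -> int}.

Let h u : dual_number B := (1, (lambda u)%:~R).
Fact jet_exp0 : h 0 = 1. Proof. by rewrite /h raddf0. Qed.
Fact jet_expD u v : h (u + v) = h u * h v.
Proof.
by rewrite /h raddfD; congr pair; rewrite /= ?mulr1 // !mul1r rmorphD addrC.
Qed.

(* [b e^u |-> b (1 + eps lambda(u))] *)
Definition jet : C -> dual_number B :=
  ma_lift (@dual_const B) (ExpMorphism jet_exp0 jet_expD).
HB.instance Definition _ := GRing.RMorphism.copy jet
  (ma_lift (@dual_const B) (ExpMorphism jet_exp0 jet_expD)).

Lemma jet_term b u : jet (mterm b u) = (b, b * (lambda u)%:~R).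
Proof.
rewrite [LHS](ma_lift_term (@dual_const B) (ExpMorphism jet_exp0 jet_expD)).
by congr pair; rewrite /= ?mulr1 // mul1r addr0.
Qed.

Lemma jet1 x : (jet x).1 = aug x.
Proof.
elim/ma_ind: x => [|b u x IH]; first by rewrite !rmorph0.
rewrite !rmorphD /= IH jet_term /=; congr (_ + _).
by rewrite mtermE rmorphM /= aug_const aug_exp mulr1.
Qed.

(** On [A], [jet] agrees with the eps-free map [aug] modulo the square-zero ideal eps I. Formal
    smoothness lifts [jet] modulo eps I to a morphism that is eps-free on [A]; its eps-component is
    the derivation. *)
Lemma jet_lift (A : comPzRingType) (m : {rmorphism A -> C}) (I : ideal B) :
  formally_smooth m -> (forall a, I (jet (m a)).2) ->
  exists D : C -> B,
    [/\ forall x y, D (x + y) = D x + D y,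
        forall x y, D (x * y) = aug x * D y + aug y * D x,
        forall a, D (m a) = 0
      & forall u, I (D (mexp B u) - (lambda u)%:~R)].
Proof.
move=> ms mI.
pose J (x : dual_number B) := x.1 = 0 /\ I x.2.
have J0 : J 0 by split=> //; apply: ideal0.
have JD x y : J x -> J y -> J (x + y).
  by move=> [x0 xI] [y0 yI]; split; [rewrite /= x0 y0 addr0|apply: idealD].
have JM a x : J x -> J (a * x).
  move=> [x0 xI]; split; rewrite /= x0 ?mulr0 // mul0r addr0.
  exact: idealMl.
pose JI := Ideal J0 JD JM; pose pi : {rmorphism _ -> quo JI} := quo_proj JI.
have piE x y : pi x = pi y <-> J (x - y) := quo_proj_eq JI x y.
have pi0 x y : pi x = 0 -> pi y = 0 -> x * y = 0.
  move=> /quo_proj_eq0[x0 _] /quo_proj_eq0[y0 _].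
  by congr pair; rewrite /= x0 y0 ?mulr0 // !mul0r addr0.
pose a : {rmorphism A -> dual_number B} := @dual_const B \o (aug \o m).
have am x : (pi \o jet) (m x) = pi (a x).
  change (pi (jet (m x)) = pi (a x)).
  apply/piE; split; first by rewrite /= jet1 subrr.
  by rewrite /= subr0; apply: mI.
have [c [cm cpi]] := ms _ _ pi a (pi \o jet) (@quo_proj_surj _ JI) pi0 am.
have cJ x : J (c x - jet x) by apply/piE; apply: cpi.
have c1 x : (c x).1 = aug x.
  by apply/eqP; rewrite -subr_eq0 -jet1; apply/eqP; have [] := cJ x.
exists (fun x => (c x).2); split=> [x y|x y|x|u].
- by rewrite rmorphD.
- by rewrite rmorphM /= !c1.
- by rewrite cm.
- have [_] := cJ (mexp B u); rewrite jet_term mul1r; exact.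
Qed.

End Jet.

End Augmentation.

(* A lift [c : B[M] -> E] of a homomorphism factoring through [aug] is corrected
   by a combination of the derivations [D i] of [jet_lift] so that it sends [M]
   to [1]; this is possible where the matrix of the [D i] on a basis of [M] is
   invertible. The corrected lift then restricts to a lift on [B]. *)
Lemma formally_smooth_slice (A B : comPzRingType) (M : zmodType) n
    (beta : 'I_n -> M) (lambda : 'I_n -> {additive M -> int})
    (m : {rmorphism A -> monoid_alg B M}) (I : ideal B) :
  (forall i l, lambda i (beta l) = (i == l)%:R) ->
  (forall u, u = \sum_i beta i *~ lambda i u) ->
  formally_smooth m ->
  (forall i a, I (@jet B M (lambda i) (m a)).2) ->
  exists2 g, I (g - 1) &
    forall (Bg : comPzRingType) (l : {rmorphism B -> Bg}),
      is_localization g l -> formally_smooth (l \o (@aug B M \o m)).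
Proof.
move=> lb bspan ms mI.
have /choice[D DP] i := jet_lift ms (mI i).
pose G : 'M[B]_n := \matrix_(i, l) D i (mexp B (beta l)).
exists (\det G).
  (* Modulo [I] the matrix is the identity, since [D i] of e^(beta l) is congruent to
     [lambda i (beta l)]. *)
  apply/quo_proj_eq.
  rewrite -(det_map_mx (quo_proj I)) [map_mx _ _](_ : _ = 1%:M) ?det1 ?rmorph1 //.
  apply/matrixP => i l; rewrite !mxE -[RHS](rmorph_nat (quo_proj I)).
  apply/quo_proj_eq; have [_ _ _ /(_ (beta l))] := DP i.
  by rewrite lb; case: (i == l).
move=> Bg l locl E E' pi a b pis pi0 bm.
have [c [cm cb]] := ms _ _ pi a (b \o (l \o @aug B M)) pis pi0 bm.
pose cB : {rmorphism B -> E} := c \o mconst M.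
have cBE x : pi (cB x) = b (l x) by rewrite /= cb /= aug_const.
have unit_lift (F : {rmorphism B -> E}) :
    (forall x, pi (F x) = b (l x)) -> exists v, F (\det G) * v = 1.
  have [[h gh] _ _] := locl => FE.
  have piF : pi (F (\det G)) * b h = 1 by rewrite FE -rmorphM gh rmorph1.
  by have [v Fv _] := square_zero_inverse pis pi0 piF; exists v.
have [v gv] := unit_lift cB cBE.
pose w : 'rV[E]_n := \row_l (c (mexp B (beta l)) - 1).
(* Cramer's rule solves y G = - w, where [w] measures how far [c] is from trivial on the basis. *)
pose y : 'rV[E]_n := - v *: (w *m map_mx cB (\adj G)).
have w0 l' : pi (w 0 l') = 0.
  by rewrite mxE rmorphB rmorph1 cb /= aug_exp rmorph1 rmorph1 subrr.
have y0 i : pi (y 0 i) = 0.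
  rewrite !mxE rmorphM rmorph_sum big1 ?mulr0 // => l' _.
  by rewrite rmorphM w0 mul0r.
have yG : y *m map_mx cB G = - w.
  rewrite -scalemxAl -mulmxA -map_mxM mul_adj_mx map_scalar_mx.
  by rewrite mul_mx_scalar scalerA mulNr mulrC [cB _ * v]gv scaleN1r.
pose d x := \sum_i y 0 i * cB (D i x).
have dB x z : d (x - z) = d x - d z.
  rewrite -sumrB; apply: eq_bigr => i _.
  have [DD _ _ _] := DP i.
  have -> : D i (x - z) = D i x - D i z.
    by rewrite -{2}[x](subrK z) (DD (x - z) z) addrK.
  by rewrite rmorphB mulrBr.
(* The entries of [y] lie in the square-zero kernel of [pi], so factors beside them matter only
   modulo this kernel, where [cB] after [aug] equals [c]. Thus [d] is a derivation along [c]. *)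
have ycB i x : y 0 i * cB (@aug B M x) = y 0 i * c x.
  apply/eqP; rewrite -subr_eq0 -mulrBr; apply/eqP/pi0 => //.
  by rewrite rmorphB cBE cb subrr.
have d0 x : pi (d x) = 0.
  by rewrite rmorph_sum big1 // => i _; rewrite rmorphM y0 mul0r.
have dM x z : d (x * z) = c x * d z + c z * d x.
  rewrite !mulr_sumr -big_split; apply: eq_bigr => i _.
  have [_ DM _ _] := DP i.
  rewrite DM (rmorphD cB) !(rmorphM cB) mulrDr !(mulrA (y 0 i)) !ycB.
  by congr (_ + _); rewrite mulrCA mulrA.
have dm x : d (m x) = 0.
  rewrite /d big1 // => i _; have [_ _ Dm _] := DP i.
  by rewrite Dm rmorph0 mulr0.
(* Adding to [c] a derivation with values in a square-zero ideal gives another ring morphism with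
   the same reduction. *)
pose c' x := c x + d x.
have c'B : zmod_morphism c'.
  by move=> x z; rewrite /c' dB rmorphB opprD addrACA.
have c'M : monoid_morphism c'.
  have d1 : d 1 = 0 by rewrite -(rmorph1 m) dm.
  split=> [|x z]; first by rewrite /c' d1 addr0 rmorph1.
  have dd : d x * d z = 0 by apply: pi0.
  by rewrite /c' rmorphM dM mulrDl !mulrDr dd addr0 addrA [d x * _]mulrC.
pose ca := GRing.isZmodMorphism.Build _ _ c' c'B.
pose cm' := GRing.isMonoidMorphism.Build _ _ c' c'M.
pose F : {rmorphism monoid_alg B M -> E} := HB.pack c' ca cm'.
have Fb l' : F (mexp B (beta l')) = 1.
  have /matrixP/(_ 0 l') := yG; rewrite !mxE => e.
  have de : d (mexp B (beta l')) = 1 - c (mexp B (beta l')).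
    by rewrite -opprB -e; apply: eq_bigr => i _; rewrite !mxE.
  change (c (mexp B (beta l')) + d (mexp B (beta l')) = 1).
  by rewrite de addrC subrK.
have FM := rmorph_aug (rmorph_exp1 (fun u => ex_intro _ _ (bspan u)) Fb).
pose F' : {rmorphism B -> E} := F \o mconst M.
have F'E x : pi (F' x) = b (l x).
  change (pi (c (mconst M x) + d (mconst M x)) = b (l x)).
  by rewrite rmorphD d0 addr0 cBE.
(* The corrected map [F'] may differ from [cB], so the invertibility of the determinant is lifted
   anew before extending to [Bg]. *)
have [v' gv'] := unit_lift F' F'E.
have [H HE] := localization_lift locl gv'.
exists H; split=> [x|].
  have Fm : F (m x) = a x.
    by change (c (m x) + d (m x) = a x); rewrite dm addr0 cm.
  by rewrite -Fm FM /= HE.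
apply: (localization_ext (F := pi \o H) (G := b) locl) => x /=.
by rewrite HE F'E.
Qed.

(** * The splitting of the semigroup of a cone *)

Lemma homZ_sum (U V : zmodType) (T : finType) (F : T -> homZ U V) u :
  (\sum_t F t) u = \sum_t F t u.
Proof. by elim/big_rec2: _ => //= t y z _ <-. Qed.

Lemma homZ_mulrz (U V : zmodType) (f : homZ U V) (e : int) u :
  (f *~ e) u = f u *~ e.
Proof.
have evB : zmod_morphism (fun f : homZ U V => f u) by [].
exact: (raddfMz (homZ_mk evB)).
Qed.

(** * The real span of a cone and the projection along a complement *)

Section RealSpan.
Variables (R : realType) (N : zmodType) (s : set (realification R N)).

Lemma real_span_fin (T : finType) (y : T -> realification R N) (c : T -> R) :
  (forall t, s (y t)) -> real_span s (\sum_t c t *: y t).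
Proof.
move=> sy; exists #|T|, (fun i => y (enum_val i)), (fun i => c (enum_val i)).
split=> [i|]; first exact: sy.
by rewrite -(@big_enum_val _ _ _ T T (fun t => c t *: y t)); apply: eq_bigl.
Qed.

Lemma span_latticeB v w :
  span_lattice s v -> span_lattice s w -> span_lattice s (v - w).
Proof.
move=> [m [x [c [sx vE]]]] [n [y [d [sy wE]]]].
rewrite /span_lattice /= (_ : lattice_incl R (v - w) =
    \sum_(t : 'I_m + 'I_n) (match t with inl i => c i | inr i => - d i end) *:
      (match t with inl i => x i | inr i => y i end)).
  by apply: real_span_fin => -[].
rewrite big_sumType /= -vE; under eq_bigr do rewrite scaleNr.
rewrite sumrN -wE; apply: homZP => u.
by rewrite /= raddfB /= rmorphB.
Qed.

Lemma span_lattice_orthogonal (u : dual_lattice N) v :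
  u \in orthogonal_lattice s -> span_lattice s v -> u v = 0.
Proof.
move=> /asboolP us [n [y [c [sy vE]]]].
have : lattice_incl R v u = 0.
  by rewrite vE homZ_sum big1 // => i _; rewrite homZZE us ?scaler0.
by move/eqP; rewrite /= intr_eq0 => /eqP.
Qed.

(** This is the projection onto the summand spanned by the cone; uniqueness of the decomposition
    makes it additive. *)
Lemma direct_sum_projection (N0 : zmodClosed N) :
  internal_direct_sum [set v | v \in N0] (span_lattice s) ->
  exists pr : {additive N -> N},
    [/\ forall v, v \in N0 -> pr v = 0,
        forall v, span_lattice s v -> pr v = v,
        forall v, span_lattice s (pr v)
      & forall v, v - pr v \in N0].
Proof.
move=> ds.
have dsE a v a' v' : a \in N0 -> span_lattice s v -> a' \in N0 ->
    span_lattice s v' -> a + v = a' + v' -> v = v'.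
  move=> a0 vs a0' vs' e; have [av [_ U]] := ds (a + v).
  have := U (a, v) (And3 a0 vs erefl).
  by rewrite (U (a', v') (And3 a0' vs' e)) => -[].
have /choice[P PE] v : exists v', v - v' \in N0 /\ span_lattice s v'.
  have [[a v'] [[/= a0 vs ->] _]] := ds v.
  by exists v'; rewrite addrK.
have span0 : span_lattice s 0.
  by have := span_latticeB (PE 0).2 (PE 0).2; rewrite subrr.
have PB : zmod_morphism P.
  move=> v w; have [[v0 vs] [w0 ws]] := (PE v, PE w).
  have [z0 zs] := PE (v - w).
  apply: (dsE _ _ ((v - P v) - (w - P w)) _ z0 zs).
  - exact: rpredB.
  - exact: span_latticeB.
  - by rewrite subrK opprB addrACA subrK addrAC subrr sub0r.
pose pr : homZ N N := homZ_mk PB.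
exists pr; split=> [v v0|v vs|v|v].
- have [z0 zs] := PE v; apply: (dsE _ _ _ _ z0 zs v0 span0).
  by rewrite subrK addr0.
- have [z0 zs] := PE v; apply: (dsE _ _ _ _ z0 zs (rpred0 N0) vs).
  by rewrite subrK add0r.
- exact: (PE v).2.
- exact: (PE v).1.
Qed.

End RealSpan.

Lemma lattice_basis (N : zmodType) : is_lattice N ->
  exists n (b : 'I_n -> N) (beta : 'I_n -> dual_lattice N),
    (forall v, v = \sum_i b i *~ beta i v) /\
    (forall i l, beta l (b i) = (i == l)%:R).
Proof.
move=> [n [b bP]].
have /choice[c cE] v := bP v.
have cU v (d : 'rV[int]_n) : v = \sum_i b i *~ d 0 i -> c v = d.
  by move=> vE; have [_ /(_ d vE)] := cE v.
have cB l : zmod_morphism (fun v => c v 0 l).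
  move=> v w; rewrite (cU (v - w) (c v - c w)) ?mxE //.
  rewrite {1}(cE v).1 {1}(cE w).1 -sumrB; apply: eq_bigr => i _.
  by rewrite !mxE mulrzBr.
exists n, b, (fun l => homZ_mk (cB l)); split=> [v|i l]; first exact: (cE v).1.
rewrite /= (cU (b i) (delta_mx 0 i)) ?mxE ?eqxx 1?eq_sym //.
rewrite (bigD1 i) //= !mxE !eqxx mulr1z big1 ?addr0 // => i' /negPf ni.
by rewrite mxE ni andbF mulr0z.
Qed.

Section ConeSplitting.
Variables (R : realType) (N : zmodType) (sigma : set (realification R N)).
Variables (N0 : zmodClosed N) (pr : {additive N -> N}).
Hypothesis prN0 : forall v, v \in N0 -> pr v = 0.
Hypothesis prS : forall v, span_lattice sigma v -> pr v = v.
Hypothesis pr_span : forall v, span_lattice sigma (pr v).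
Hypothesis prB : forall v, v - pr v \in N0.
Hypothesis sigma_poly : rational_polyhedral sigma.
Variables (n : nat) (b : 'I_n -> N) (beta : 'I_n -> dual_lattice N).
Hypothesis bE : forall v, v = \sum_i b i *~ beta i v.

Let M := dual_lattice N.
Let p := quotient_map N0.
Let sigma0 := real_map p @` sigma.
Let K := cone_monoid sigma.
Let K0 := cone_monoid sigma0.
Let j : {additive K0 -> K} := cone_monoid_map p sigma.

Let p_pr v : p (pr v) = p v.
Proof.
apply/eqP; rewrite eq_sym /p /quotient_map -Quotient.idealrBE; exact: prB.
Qed.

Let pull_subproof (u : M) : zmod_morphism (fun v => u (pr v)).
Proof. by move=> v w; rewrite !raddfB. Qed.
Let pull (u : M) : M := homZ_mk (pull_subproof u).

(** The cone is generated by lattice vectors, and [pr] fixes them. *)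
Let cone_pull x u : sigma x -> x (pull u) = x u.
Proof.
have [m [v sE]] := sigma_poly.
have vs i : span_lattice sigma (v i).
  exists 1%N, (fun=> lattice_incl R (v i)), (fun=> 1).
  rewrite big_ord1 scale1r; split=> // _; rewrite sE.
  exists (fun l => (l == i)%:R) => [l|]; first exact: Num.Theory.ler0n.
  by rewrite (bigD1 i) //= eqxx scale1r big1 ?addr0 // => l /negPf ->;
    rewrite scale0r.
rewrite sE => -[c _ ->]; rewrite !homZ_sum; apply: eq_bigr => i _.
by rewrite !homZZE /= prS.
Qed.

(** As [pr] kills [N0], the functional u o pr descends to the quotient lattice and can be computed
    on representatives. *)
Let desc_subproof (u : M) :
  zmod_morphism (fun z : quotient_group N0 => u (pr (repr z))).
Proof.
have pE (v w : N) : p v = p w -> pr v = pr w.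
  move=> /eqP; rewrite /p /quotient_map -Quotient.idealrBE => /prN0/eqP.
  by rewrite raddfB subr_eq0 => /eqP.
move=> y z; rewrite -!raddfB; congr (u _); apply: pE.
by rewrite raddfB /p /quotient_map /= !reprK.
Qed.
Let desc (u : M) : dual_lattice (quotient_group N0) := homZ_mk (desc_subproof u).

Let descK u : dual_map p (desc u) = pull u.
Proof.
apply: homZP => v; change (u (pr (repr (p v))) = u (pr v)); congr (u _).
have : p (repr (p v)) = p v by rewrite /p /quotient_map /= reprK.
move=> /eqP; rewrite /p /quotient_map -Quotient.idealrBE => /prN0/eqP.
by rewrite raddfB subr_eq0 => /eqP.
Qed.

Let dual_map_inj : injective (dual_map p).
Proof.
move=> u v uv; apply: homZP => z; rewrite -[z]reprK.
exact: (congr1 (fun f : M => f (repr z)) uv).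
Qed.

Let proj_subproof (u : K) : desc u \in dual_cone sigma0.
Proof.
apply/asboolP => _ [x sx <-].
change (0 <= x (dual_map p (desc u))); rewrite descK cone_pull //.
exact: cone_monoidP.
Qed.
Let proj (u : K) : K0 := ConeMonoid (proj_subproof u).

Let j_proj u : cone_char (j (proj u)) = pull u.
Proof. exact: descK. Qed.

Let j_inj : injective j.
Proof.
by move=> u v /(congr1 (@cone_char _ _ _)) uv; apply/val_inj/dual_map_inj.
Qed.

Let proj_is_nmod_morphism : nmod_morphism proj.
Proof.
by split=> [|u v]; apply/j_inj/val_inj; rewrite /= ?raddfD ?raddf0;
  apply: homZP => w //=; rewrite ?j_proj.
Qed.

(** The value of u - pull u at [b i], hence its coordinates in the basis [beta] of the whole dual
    lattice. *)
Let coord i (u : K) : int := cone_char u (b i - pr (b i)).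

Let coordD i u v : coord i (u + v) = coord i u + coord i v.
Proof. by []. Qed.

Let coord_base i v : coord i (j v) = 0.
Proof.
change (cone_char v (p (b i - pr (b i))) = 0).
by rewrite raddfB p_pr subrr raddf0.
Qed.

Let projK v : proj (j v) = v.
Proof.
apply/j_inj/val_inj; rewrite /= descK; apply: homZP => w.
by change (cone_char v (p (pr w)) = cone_char v (p w)); rewrite p_pr.
Qed.

(** The functional beta_i - pull beta_i vanishes on the cone, so its negative multiples belong to
    the semigroup too. *)
Let gen_subproof i (e : int) : (beta i - pull (beta i)) *~ e \in dual_cone sigma.
Proof.
apply/asboolP => x sx.
by rewrite raddfMz raddfB /= cone_pull // subrr mul0rz.
Qed.
Let gen i (e : int) : K := ConeMonoid (gen_subproof i e).

Let proj_gen i : proj (gen i 1) = 0.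
Proof.
apply/j_inj/val_inj; rewrite /= descK raddf0; apply: homZP => v.
change (beta i (pr v) - beta i (pr (pr v)) = 0).
by rewrite (prS (pr_span v)) subrr.
Qed.

Let genN i : gen i 1 + gen i (- 1) = 0.
Proof. by apply: val_inj; rewrite /= -mulrzDr subrr. Qed.

Let decomp u : u = j (proj u) + \sum_i gen i (coord i u).
Proof.
apply/val_inj; rewrite raddfD raddf_sum /= descK; apply: homZP => v.
rewrite homZDE homZ_sum.
transitivity (cone_char u (pr v) + cone_char u (v - pr v)).
  by rewrite -raddfD addrC subrK.
congr (_ + _).
(* [u'] agrees with [u] on v - pr v, because [pr] kills that vector, and its values on the basis [b]
   are the coordinates [coord]. *)
pose u' : M := cone_char u - pull (cone_char u).
transitivity (u' (v - pr v)).
  change (cone_char u (v - pr v) =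
    cone_char u (v - pr v) - cone_char u (pr (v - pr v))).
  by rewrite (prN0 (prB v)) raddf0 subr0.
rewrite {1}(bE (v - pr v)) raddf_sum; apply: eq_bigr => i _.
rewrite homZ_mulrz raddfMz !mulrzz [RHS]mulrC raddfB.
by congr (_ * _); rewrite /coord raddfB.
Qed.

Lemma cone_splitting : lattice_splitting (cone_monoid_map p sigma) n.
Proof.
pose ha := GRing.isNmodMorphism.Build K K0 proj proj_is_nmod_morphism.
pose pj : {additive K -> K0} := HB.pack proj ha.
apply: (@LatticeSplitting K0 K j n pj coord (fun i => gen i 1)
  (fun i => gen i (- 1))) => //.
move=> S h u; rewrite [in LHS](decomp u) exp_funD; congr (_ * _).
elim/big_rec2: _ => [|i y v _ <-]; first exact: exp_fun0.
rewrite exp_funD; congr (_ * _).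
(* Natural multiples in the monoid become powers under [h]; negative ones are natural multiples of
   [gen i (- 1)]. *)
have hMn (v' : K) m : h (v' *+ m) = h v' ^+ m.
  elim: m => [|m IHm]; first exact: exp_fun0.
  by rewrite mulrS exp_funD IHm exprS.
have genMn e m : gen i (e *~ m%:Z) = gen i e *+ m.
  by apply: val_inj; rewrite raddfMn /= mulrzz mulrzA pmulrn.
case: (coord i u) => m /=; rewrite -hMn -genMn; congr (h (gen i _)).
  by rewrite mulrzz mul1r.
by rewrite NegzE mulrzz mulN1r.
Qed.

(** A functional coming from N/N0 is determined by its values on the image of [pr], which lies in
    the span of the cone. So a nonzero element of the semigroup of sigma_0 is not orthogonal to
    sigma. *)
Lemma cone_base_orthogonal (v : K0) :
  cone_char (cone_monoid_map p sigma v) \in orthogonal_lattice sigma ->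
  cone_char (cone_monoid_map p sigma v) = 0.
Proof.
move=> vs; apply: homZP => w.
transitivity (cone_char (j v) (pr w)); last exact: span_lattice_orthogonal vs _.
by change (cone_char v (p w) = cone_char v (p (pr w))); rewrite p_pr.
Qed.

End ConeSplitting.

(** * Smoothness of the projection *)

Section MultMorphism.
Variables (k : fieldType) (R : realType) (N : zmodType).
Variables (s : set (realification R N)) (B : comPzRingType).
Variable rho : {rmorphism toric_ring k s -> B}.

Lemma mult_morphism_term c (u : cone_monoid s) :
  mult_morphism rho (mterm c u) = mterm (rho (mterm c u)) (cone_char u).
Proof.
have actE : torus_action (mterm c u : toric_ring k s) =
    mconst _ (mterm c u) * mexp _ (cone_char u).
  have actC : torus_action (mconst _ c : toric_ring k s) = mconst _ (mconst _ c).
    exact: (ma_lift_const (mconst _ \o mconst _) (ExpMorphism _ _)).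
  have := torus_action_chi k u; rewrite /chi => actX.
  by rewrite mtermE !rmorphM /= actC actX mulrA.
rewrite [LHS](_ : _ = ma_map rho (torus_action (mterm c u))) // actE rmorphM /=.
by rewrite ma_map_const ma_map_exp -mtermE.
Qed.

(** The unit of the torus acts trivially. *)
Lemma aug_mult_morphism x : aug (mult_morphism rho x) = rho x.
Proof.
elim/ma_ind: x => [|c u x IH]; first by rewrite !rmorph0.
rewrite !rmorphD /= IH mult_morphism_term mtermE rmorphM /=.
by rewrite aug_const aug_exp mulr1.
Qed.

End MultMorphism.

(** The orbit map multiplies e^u by the value of chi^u at the distinguished point, which is 0 for
    such [u]; the preimage of any prime therefore contains the term. *)
Lemma torus_orbit_vanish (k : fieldType) (R : realType) (N : zmodType)
    (s : set (realification R N)) (P : set (toric_ring k s)) c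
    (u : cone_monoid s) :
  torus_orbit P -> cone_char u \notin orthogonal_lattice s -> P (mterm c u).
Proof.
move=> [Q [Q0 _ _ _ _] ->] us.
have d0 : @distinguished_point k R N s (mterm c u) = 0.
  have := distinguished_point_chi k u; rewrite /chi (negbTE us) => dX.
  by rewrite mtermE rmorphM /= dX mulr0.
by rewrite /preimage /= mult_morphism_term /= d0 mterm0.
Qed.

Theorem lemma7p3 (k : closedFieldType) (R : realType) (N : zmodType)
    (sigma : set (realification R N)) (N0 : zmodClosed N)
    (B : comPzRingType) (rho : {rmorphism toric_ring k sigma -> B}) :
  [pchar k] =i pred0 ->
  is_lattice N ->
  rational_polyhedral sigma ->
  strongly_convex sigma ->
  internal_direct_sum [set v | v \in N0] (span_lattice sigma) ->
  (forall y, exists x, rho x = y) ->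
  let p := quotient_map N0 in
  let pY : {rmorphism toric_ring k (real_map p @` sigma) -> B} :=
    rho \o toric_morphism k p sigma in
  smooth (mult_morphism rho) ->
  forall q : set B,
    prime_ideal q -> torus_orbit (rho @^-1` q) -> smooth_at pY q.
Proof.
move=> _ latN poly _ ds rho_surj p pY [mfp mfs] q [q0 qD qM q1 _] orb.
have [n [b [beta [bE bb]]]] := lattice_basis latN.
have [pr [prN0 prS pr_span prB]] := direct_sum_projection ds.
have sp := cone_splitting prN0 prS pr_span prB poly bE.
pose J : {rmorphism _ -> toric_ring k sigma} := toric_morphism k p sigma.
have Jfp : finitely_presented J := lattice_extension_finitely_presented k sp.
have Jfs : formally_smooth J := lattice_extension_formally_smooth sp.
pose I := Ideal q0 qD qM.
have evB i : zmod_morphism (fun u : dual_lattice N => u (b i)) by [].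
pose ev i : homZ (dual_lattice N) int := homZ_mk (evB i).
have evE u : u = \sum_i beta i *~ ev i u.
  apply: homZP => v; rewrite homZ_sum {1}(bE v) raddf_sum.
  by apply: eq_bigr => i _; rewrite homZ_mulrz raddfMz !mulrzz mulrC.
have evb i l : ev i (beta l) = (i == l)%:R by exact: bb.
(* On a monomial of the semigroup of sigma_0 the eps-part is its image under [rho] times a value of
   its exponent: the exponent is zero if orthogonal to sigma, and otherwise the image lies in
   [q]. *)
have jetI i a : I (jet (ev i) ((mult_morphism rho \o J) a)).2.
  elim/ma_ind: a => [|c u a IH]; first by rewrite !rmorph0; apply: (ideal0 I).
  rewrite !rmorphD; apply: (idealD (i := I)) => //.
  have JE : J (mterm c u) = mterm c (cone_monoid_map p sigma u).
    exact: (ma_reindex_term (cone_monoid_map p sigma)).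
  change (I (jet (ev i) (mult_morphism rho (J (mterm c u)))).2).
  rewrite JE mult_morphism_term jet_term [snd _]mulrC.
  have [us|us] := boolP (cone_char (cone_monoid_map p sigma u)
                         \in orthogonal_lattice sigma).
    have ev0 := congr1 (ev i) (cone_base_orthogonal pr_span prB us).
    by rewrite [ev i _]ev0 mul0r; apply: (ideal0 I).
  apply: (idealMl (i := I)); exact: (torus_orbit_vanish c orb us).
(* The smooth locus is found as the nonvanishing of a determinant [g] congruent to 1 modulo [q],
   hence outside [q]. *)
have [g gI gP] := formally_smooth_slice evb evE
  (formally_smooth_comp Jfs mfs) jetI.
exists g.
  move=> qg; apply: q1; rewrite -[1](subKr g).
  exact: (idealB (I := I)).
have [Bg [l locl]] := localization_exists g.
exists Bg, l; split=> //; split.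
  (* [rho] is the multiplication morphism followed by [aug], a quotient by finitely many elements;
     so it is finitely presented and, being surjective, has a finitely generated kernel. *)
  have /finitely_presented_surj_ker/(_ rho_surj)[r [h hker]] :
      finitely_presented rho.
    apply: (finitely_presented_ext (f := @aug B _ \o mult_morphism rho)).
      exact: aug_mult_morphism.
    apply: (finitely_presented_quotient mfp) (aug_ker _) => [x|u].
      by exists (mconst _ x); exact: aug_const.
    by exists (fun i => ev i u); exact: evE.
  (* [B] is thus the quotient of k[S], finitely presented over k[S0], by a finitely generated
     ideal. *)
  apply: (finitely_presented_localization (f := pY)) locl.
  exact: finitely_presented_quotient Jfp rho_surj hker.
apply: formally_smooth_ext (gP Bg l locl) => x.
by rewrite /= aug_mult_morphism.
Qed.
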